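(* Let $\Gamma:\mathfrak g=\bigoplus_{j\in\mathbb Z}\mathfrak g_j$ be an $e$-admissible grading of $\mathfrak g$ such that $e\in\mathfrak g_a$ ($a>1$ an integer) and $$\mathfrak g_{<0}=\mathfrak g_{\le -a}\oplus(\mathfrak g_{b-a}+\mathfrak g_{-b})$$ for some $b\in\,]0,\tfrac a2]$. Then the $e$-admissible pairs relative to $\Gamma$ are equivalent to each other.
   Context: $\mathfrak g$ is a finite-dimensional simple Lie algebra over $\mathbb C$ with Killing form; $e\in\mathfrak g$ is nilpotent, $\mathfrak g^e$ its centralizer; $\perp$ is with respect to the Killing form. For a grading, $\mathfrak g_{\le k}=\bigoplus_{j\le k}\mathfrak g_j$, $\mathfrak g_{<k}=\bigoplus_{j<k}\mathfrak g_j$; a subspace is graded if it is the direct sum of its intersections with the $\mathfrak g_j$. A pair $(\mathfrak m,\mathfrak n)$ of subalgebras of $\mathfrak g$ is $e$-admissible relative to a $\mathbb Z$-grading $\Gamma:\mathfrak g=\bigoplus_{j\in\mathbb Z}\mathfrak g_j$ with integer $a>1$ if: (A1) $e\in\mathfrak g_a$; (A2) $\mathfrak m,\mathfrak n$ are graded and $\mathfrak g_{\le -a}\subseteq\mathfrak m\subseteq\mathfrak n\subseteq\mathfrak g_{<0}$; (A3) $\mathfrak m^\perp\cap[\mathfrak g,e]=[\mathfrak n,e]$; (A4) $\mathfrak n\cap\mathfrak g^e=\{0\}$; (A5) $[\mathfrak n,\mathfrak m]\subseteq\mathfrak m$; (A6) $\dim\mathfrak m+\dim\mathfrak n=\dim\mathfrak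 g-\dim\mathfrak g^e$. A grading is $e$-admissible if such a pair exists; a pair is $e$-admissible if it is so relative to some $\mathbb Z$-grading. Two $e$-admissible pairs $(\mathfrak m,\mathfrak n)$, $(\mathfrak m',\mathfrak n')$ are comparable if there is a $\mathbb Z$-grading relative to which both are $e$-admissible and either $\mathfrak m\subseteq\mathfrak m'\subseteq\mathfrak n'\subseteq\mathfrak n$ or $\mathfrak m'\subseteq\mathfrak m\subseteq\mathfrak n\subseteq\mathfrak n'$. Two $e$-admissible pairs are equivalent if they are joined by a finite sequence of $e$-admissible pairs in which any two consecutive ones are comparable. *)

(* Defs.v *)
From HB Require Import structures.
From mathcomp Require Import all_boot all_order all_algebra.
From mathcomp Require Import reals complex.

Set Implicit Arguments.
Unset Strict Implicit.
Unset Printing Implicit Defensive.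

Import Order.TTheory GRing.Theory Num.Theory.
Local Open Scope ring_scope.

(* A finite-dimensional Lie algebra over K. *)
HB.mixin Record Vector_isLie (K : fieldType) g & Vector K g := {
  lie : g -> g -> g;
  lie_linearl : forall y, linear (lie^~ y);
  lie_linearr : forall x, linear (lie x);
  lie_alt : forall x, lie x x = 0;
  lie_jacobi : forall x y z,
    lie x (lie y z) + lie y (lie z x) + lie z (lie x y) = 0
}.

#[short(type="lieAlgType")]
HB.structure Definition LieAlg (K : fieldType) := {g of Vector_isLie K g & Vector K g}.

Section LieTheory.
Variables (K : fieldType) (g : lieAlgType K).
Implicit Types (x y z e : g) (U V I m n : {vspace g}).

Definition ad x : 'End(g) := linfun (lie x).
Definition adr y : 'End(g) := linfun (lie^~ y).

Lemma adE x y : ad x y = lie x y.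
Proof.
pose h : {linear g -> g} := HB.pack (lie x)
  (GRing.isSemilinear.Build _ _ _ _ _ (GRing.semilinear_linear (lie_linearr x))).
exact: (lfunE h).
Qed.

Lemma adrE x y : adr y x = lie x y.
Proof.
pose h : {linear g -> g} := HB.pack (lie^~ y)
  (GRing.isSemilinear.Build _ _ _ _ _ (GRing.semilinear_linear (lie_linearl y))).
exact: (lfunE h).
Qed.

Definition endtrace (f : 'End(g)) : K :=
  \tr (passmx.mxof (vbasis {:g}) (vbasis {:g}) f).

Definition killing x y : K := endtrace (ad x \o ad y)%VF.

Lemma killing_linearl y : linear (killing^~ y : g -> K^o).
Proof.
move=> c x x'; rewrite /killing /endtrace.
have -> : ad (c *: x + x') = c *: ad x + ad x'.
  by apply/lfunP=> z; rewrite !lfunE /= lfunE /= !adE lie_linearl.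
by rewrite comp_lfunDl -comp_lfunZl passmx.mxof_linear mxtraceD mxtraceZ.
Qed.

(* By linearity, it suffices to test orthogonality on a basis of U;
   see killing_perpP. *)
Definition killing_perp U : {vspace g} :=
  (\bigcap_(y <- vbasis U) lker (linfun (killing^~ y : g -> K^o)))%VS.

Lemma killingC x y : killing x y = killing y x.
Proof.
have bB : basis_of {:g} (vbasis {:g}) := vbasisP _.
by rewrite /killing /endtrace !(passmx.mxof_comp _ _ bB) mxtrace_mulC.
Qed.

Lemma killing_perpP U x :
  reflect (forall y, y \in U -> killing x y = 0) (x \in killing_perp U).
Proof.
have kE z y : linfun (killing^~ y : g -> K^o) z = killing z y.
  pose h : {linear g -> K^o} := HB.pack (killing^~ y : g -> K^o)
    (GRing.isSemilinear.Build _ _ _ _ _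
      (GRing.semilinear_linear (killing_linearl y))).
  exact: (lfunE h).
have lE (s : seq g) :
  (x \in (\bigcap_(y <- s) lker (linfun (killing^~ y : g -> K^o)))%VS)
    = all (fun y => killing x y == 0) s.
  elim: s => [|y s IH]; first by rewrite big_nil memvf.
  by rewrite big_cons memv_cap IH memv_ker kE.
rewrite /killing_perp lE; apply: (iffP allP) => [H y yU|H y yB].
  rewrite (coord_vbasis yU) killingC.
  rewrite -(kE _ x) linear_sum big1 // => i _.
  rewrite linearZ /= kE killingC.
  by rewrite (eqP (H _ _)) ?scaler0 ?mem_nth ?size_tuple.
by rewrite H ?vbasis_mem.
Qed.

Definition lie_ideal I : Prop := forall x y, y \in I -> lie x y \in I.

Definition lie_subalgebra U : Prop :=
  forall x y, x \in U -> y \in U -> lie x y \in U.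

Definition lie_simple : Prop :=
  (exists x y : g, lie x y != 0) /\
  (forall I, lie_ideal I -> I = 0%VS \/ I = {:g}%VS).

(* For simple g, an element is nilpotent iff it is ad-nilpotent, by definition. *)
Definition lie_nilpotent e : Prop :=
  exists k : nat, forall x, iter k (lie e) x = 0.

Definition lie_centralizer e : {vspace g} := lker (ad e).

(* Since g is finite-dimensional, only finitely many pieces of a grading are
   nonzero; [gsupp] is any finite list of degrees containing all those with a
   nonzero piece, and nothing below depends on its choice. *)
Record grading := Grading {
  gpart :> int -> {vspace g};
  gsupp : seq int;
  gsupp_uniq : uniq gsupp;
  gpart0 : forall j, j \notin gsupp -> gpart j = 0%VS;
  gpart_direct : directv (\sum_(j <- gsupp) gpart j);
  gpart_full : (\sum_(j <- gsupp) gpart j)%VS = {:g}%VS;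
  gpart_lie : forall i j x y,
    x \in gpart i -> y \in gpart j -> lie x y \in gpart (i + j)
}.

Definition grading_le (G : grading) (k : int) : {vspace g} :=
  (\sum_(j <- gsupp G | (j <= k)%R) G j)%VS.

Definition grading_lt (G : grading) (k : int) : {vspace g} :=
  (\sum_(j <- gsupp G | (j < k)%R) G j)%VS.

(* The sum is automatically direct. *)
Definition graded_subspace (G : grading) U : Prop :=
  U = (\sum_(j <- gsupp G) (U :&: G j))%VS.

(* [adr e @: U] is the subspace [U, e]. *)
Record admissible_with e (G : grading) (a : int) m n : Prop := AdmissibleWith {
  adm_subm : lie_subalgebra m;
  adm_subn : lie_subalgebra n;
  adm_a : 1 < a;
  adm_A1 : e \in G a;
  adm_A2gr : graded_subspace G m /\ graded_subspace G n;
  adm_A2sub : [/\ (grading_le G (- a) <= m)%VS, (m <= n)%VS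
                & (n <= grading_lt G 0)%VS];
  adm_A3 : (killing_perp m :&: (adr e @: {:g}))%VS = (adr e @: n)%VS;
  adm_A4 : (n :&: lie_centralizer e)%VS = 0%VS;
  adm_A5 : forall x y, x \in n -> y \in m -> lie x y \in m;
  (* the subtraction never truncates, as g^e is a subspace of g *)
  adm_A6 : (\dim m + \dim n = \dim {:g} - \dim (lie_centralizer e))%N
}.

Definition admissible_rel e (G : grading) m n : Prop :=
  exists a : int, admissible_with e G a m n.

Definition admissible_grading e (G : grading) : Prop :=
  exists m n, admissible_rel e G m n.

Definition admissible_pair e (p : {vspace g} * {vspace g}) : Prop :=
  exists G : grading, admissible_rel e G p.1 p.2.

Definition comparable_pairs e (p q : {vspace g} * {vspace g}) : Prop :=
  exists G : grading,
    [/\ admissible_rel e G p.1 p.2, admissible_rel e G q.1 q.2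
      & [/\ (p.1 <= q.1)%VS, (q.1 <= q.2)%VS & (q.2 <= p.2)%VS] \/
        [/\ (q.1 <= p.1)%VS, (p.1 <= p.2)%VS & (p.2 <= q.2)%VS]].

Definition equivalent_pairs e (p q : {vspace g} * {vspace g}) : Prop :=
  exists (k : nat) (s : nat -> {vspace g} * {vspace g}),
    [/\ s 0%N = p, s k = q,
        forall i : nat, (i <= k)%N -> admissible_pair e (s i)
      & forall i : nat, (i < k)%N -> comparable_pairs e (s i) (s i.+1)].

End LieTheory.

(* Main.v *)
Require Import Defs.
From HB Require Import structures.
From mathcomp Require Import all_boot all_order all_algebra.
From mathcomp Require Import reals complex zify.

Set Implicit Arguments.
Unset Strict Implicit.
Unset Printing Implicit Defensive.

Import Order.TTheory GRing.Theory Num.Theory.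
Local Open Scope ring_scope.

(** Write [omega x y] for the Killing form of [[x, y]] and [e], an alternating
    form with radical [g^e]. Given (A4), condition (A3) says that the
    [omega]-orthogonal of [m] is [n + g^e], and then (A6) follows from the
    nondegeneracy of the Killing form (Cartan's criterion).

    Let [P = g_{<= -a}] and [M = P + g_{b-a}]. Every admissible pair [(m, n)] is
    joined to a normal form attached to any complement [C] of [M /\ g^e] in [M]
    containing [P + (n /\ M)]: the normal form is [(P, C)] when [2b = a], and
    [(C, C)] when [2b < a], in which case [(m /\ M, n + C)] is an intermediate
    pair. A hyperplane [H] of [C] containing [P] comes from an admissible pair
    whose second member meets [M] inside [H], and this pair is joined to the
    normal forms of all complements containing [H]. Exchanging the vectors of a
    basis one at a time then connects any two complements. *)

(** * Generalised eigenspaces *)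

Section PolynomialInterpolation.
Variable F : fieldType.

Lemma coprimep_prod_XsubC_exp (s : seq F) (l : F) k : l \notin s ->
  coprimep (('X - l%:P) ^+ k) (\prod_(m <- s) ('X - m%:P) ^+ k).
Proof.
move=> ls; rewrite coprimep_expl // coprimep_sym coprimep_XsubC.
elim: s ls => [|m s IH]; first by rewrite big_nil rootC oner_eq0.
rewrite inE negb_or => /andP[lm ls]; rewrite big_cons rootM negb_or IH // andbT.
by case: k {IH} => [|k]; rewrite ?rootC ?oner_eq0 // root_exp_XsubC.
Qed.

(** Chinese remaindering, one point at a time: the correction is a multiple of [Q], so it preserves
    the earlier congruences, and [v * Q] is 1 modulo [L]. *)
Lemma poly_interp_XsubC_exp (c : F -> F) (s : seq F) k : uniq s ->
  exists q : {poly F},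
    forall l, l \in s -> ('X - l%:P) ^+ k %| q - (c l)%:P.
Proof.
elim: s => [|l s IH]; first by exists 0.
rewrite cons_uniq => /andP[ls /IH[q qP]].
have /Bezout_eq1_coprimepP[[u v] /= uv] := coprimep_prod_XsubC_exp k ls.
set L := ('X - l%:P) ^+ k in uv *; set Q := \prod_(m <- s) _ in uv.
exists (q + ((c l)%:P - q) * (v * Q)) => m; rewrite inE => /orP[/eqP->|ms].
  have -> : v * Q = 1 - u * L by rewrite -uv addrC addKr.
  rewrite mulrBr mulr1 addrA [q + _]addrC subrK addrAC subrr add0r dvdpNr.
  by rewrite mulrA dvdp_mull.
rewrite addrAC dvdp_add ?qP // mulrA dvdp_mull //.
by rewrite /Q (big_rem m) //= dvdp_mulIl.
Qed.

End PolynomialInterpolation.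

Section TriangularMatrices.
Variable F : fieldType.

Lemma trig_mulmx n (A B : 'M[F]_n) : is_trig_mx A -> is_trig_mx B ->
  is_trig_mx (A *m B).
Proof.
move=> /is_trig_mxP At /is_trig_mxP Bt; apply/is_trig_mxP=> i j ij.
rewrite mxE big1 // => k _; have [ik|ki] := ltnP i k; first by rewrite At ?mul0r.
by rewrite Bt ?mulr0 // (leq_ltn_trans ki).
Qed.

Lemma trig_mulmx_diag n (A B : 'M[F]_n) i : is_trig_mx A -> is_trig_mx B ->
  (A *m B) i i = A i i * B i i.
Proof.
move=> /is_trig_mxP At /is_trig_mxP Bt; rewrite mxE (bigD1 i) //= big1 ?addr0 //.
move=> k; rewrite neq_ltn => /orP[ki|ik]; last by rewrite At ?mul0r.
by rewrite Bt ?mulr0.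
Qed.

Lemma trig_horner_mx n (A : 'M[F]_n.+1) p : is_trig_mx A ->
  is_trig_mx (horner_mx A p) /\ forall i, (horner_mx A p) i i = p.[A i i].
Proof.
move=> At; elim/poly_ind: p => [|p c [IHt IHd]].
  by rewrite rmorph0; split=> [|i]; rewrite ?mx0_is_trig // mxE horner0.
rewrite rmorphD rmorphM /= horner_mx_X horner_mx_C; split=> [|i]; last first.
  by rewrite mxE trig_mulmx_diag // IHd !mxE eqxx hornerMXaddC.
apply/is_trig_mxP=> i j ij; rewrite mxE (is_trig_mxP (trig_mulmx IHt At)) // add0r.
by rewrite mxE -val_eqE ltn_eqF.
Qed.

End TriangularMatrices.

Section ConjugateSemisimplePart.
Variable K : numClosedFieldType.

Lemma trig_similar n (A : 'M[K]_n.+1) : exists P T : 'M[K]_n.+1,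
  [/\ P \in unitmx, is_trig_mx T & A = invmx P *m T *m P].
Proof.
have [P /unitarymx_unit Pu AP] := Schur A (ltn0Sn n).
exists P, (P *m A *m invmx P); split=> //.
  by move: AP; rewrite /similar_to /= conjumx.
by rewrite !mulmxA mulVmx // mul1mx -mulmxA mulVmx // mulmx1.
Qed.

Lemma mxtrace_horner_similar n (A P T : 'M[K]_n.+1) p :
  P \in unitmx -> is_trig_mx T -> A = invmx P *m T *m P ->
  \tr (horner_mx A p) = \sum_i p.[T i i].
Proof.
move=> Pu Tt ->; rewrite horner_mx_uconjC //= mxtrace_mulC mulmxA mulmxV // mul1mx.
by apply: eq_bigr => i _; rewrite (trig_horner_mx p Tt).2.
Qed.

(* [B] is the endomorphism acting on each generalised eigenspace of [A] by the
   conjugate of the eigenvalue, up to degree [2n] so that brackets of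
   generalised eigenvectors are covered. *)
Lemma conj_semisimple_part n (A : 'M[K]_n) : exists s : seq K,
  (forall Q : 'rV[K]_n -> Prop, (forall u v, Q u -> Q v -> Q (u + v)) ->
     Q 0 ->
     (forall l (v : 'rV[K]_n), l \in s -> v *m (A - l%:M) ^+ n = 0 -> Q v) ->
     forall v, Q v) /\
  (forall S : seq K, {subset s <= S} -> exists B : 'M[K]_n,
     (forall l (v : 'rV[K]_n), l \in S -> v *m (A - l%:M) ^+ (n + n) = 0 ->
        v *m B = l^* *: v) /\
     (\tr (A *m B) = 0 -> A ^+ n = 0)).
Proof.
case: n A => [|n] A.
  exists [::]; split=> [Q _ Q0 _ v|S _]; first by rewrite thinmx0.
  exists 0; split=> [l v _ _|_]; first by rewrite [LHS]thinmx0 [RHS]thinmx0.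
  by apply/matrixP=> -[].
have [P [T [Pu Tt AE]]] := trig_similar A.
pose t := [seq T i i | i : 'I_n.+1].
have tsz : size t = n.+1 by rewrite size_map size_enum_ord.
have charT : char_poly T = \prod_(l <- t) ('X - l%:P).
  by rewrite char_poly_trig // big_map big_enum.
have annA p : char_poly T %| p -> horner_mx A p = 0.
  move=> /dvdpP[q ->]; rewrite rmorphM /= {2}AE horner_mx_uconjC //.
  by rewrite Cayley_Hamilton mulmx0 mul0mx mulr0.
have evalA p k l : ('X - l%:P) ^+ k %| p -> forall v : 'rV[K]_n.+1,
    v *m (A - l%:M) ^+ k = 0 -> v *m horner_mx A p = 0.
  move=> /dvdpP[q ->] v v0; rewrite mulrC rmorphM rmorphXn rmorphB /=.
  by rewrite horner_mx_X horner_mx_C mulmxA v0 mul0mx.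
exists (undup t); split.
  move=> Q QD Q0 QE.
  (* Primary decomposition by induction on the list of eigenvalues: Bezout splits a vector into one
     killed by the power for [l] and one killed by the remaining product. *)
  suff gen (r : seq K) : uniq r -> {subset r <= undup t} -> forall v : 'rV[K]_n.+1,
      v *m horner_mx A (\prod_(l <- r) ('X - l%:P) ^+ n.+1) = 0 -> Q v.
    (* Multiplicities are at most the size of [A], so the product is a multiple of the
       characteristic polynomial and Cayley-Hamilton applies. *)
    move=> v; apply: (gen (undup t) (undup_uniq t)) => //.
    rewrite annA ?mulmx0 // charT -prodr_undup_exp_count.
    elim/big_ind2: _ => // [p1 q1 p2 q2 d1 d2|l _]; first exact: dvdp_mul.
    by rewrite dvdp_exp2l // -tsz count_size.
  elim: r => [|l r IH]; first by move=> _ _ v; rewrite big_nil rmorph1 mulmx1 => ->.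
  rewrite cons_uniq => /andP[lr ur] sub v; rewrite big_cons => v0.
  have /Bezout_eq1_coprimepP[[x y] /= xy] := coprimep_prod_XsubC_exp n.+1 lr.
  set L := ('X - l%:P) ^+ n.+1 in v0 xy; set R := \prod_(m <- r) _ in v0 xy.
  have -> : v = v *m horner_mx A (y * R) + v *m horner_mx A (x * L).
    by rewrite -mulmxDr -rmorphD /= addrC xy rmorph1 mulmx1.
  apply: QD.
    apply: (QE l); first by apply: sub; rewrite mem_head.
    have -> : (A - l%:M) ^+ n.+1 = horner_mx A L.
      by rewrite rmorphXn rmorphB /= horner_mx_X horner_mx_C.
    rewrite -mulmxA -[_ *m horner_mx A L]/(_ * _) -rmorphM /= -mulrA mulrC.
    by rewrite [R * L]mulrC rmorphM mulmxA v0 mul0mx.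
  apply: IH => // [m mr|]; first by apply: sub; rewrite inE mr orbT.
  rewrite -mulmxA -[_ *m horner_mx A R]/(_ * _) -rmorphM /= -mulrA mulrC.
  by rewrite rmorphM mulmxA v0 mul0mx.
move=> S sS.
have [q qP] := poly_interp_XsubC_exp (fun l : K => l^*) (n.+1 + n.+1) (undup_uniq S).
exists (horner_mx A q); split=> [l v lS v0|].
  have /evalA/(_ v v0) : ('X - l%:P) ^+ (n.+1 + n.+1) %| q - (l^*)%:P.
    by rewrite qP // mem_undup.
  rewrite rmorphB /= horner_mx_C mulmxBr mul_mx_scalar => /eqP.
  by rewrite subr_eq0 => /eqP.
rewrite -{1}[A]horner_mx_X -[_ *m _]/(_ * _) -rmorphM /=.
rewrite (mxtrace_horner_similar _ Pu Tt AE) => tr0.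
(* [q] sends each diagonal entry of [T] to its conjugate, so the trace is a sum of squared moduli,
   each of which must vanish. *)
have T0 i : T i i = 0.
  have qT j : q.[T j j] = (T j j)^*.
    have Tj : T j j \in undup S.
      by rewrite mem_undup sS // mem_undup; apply/mapP; exists j; rewrite ?mem_enum.
    have : ('X - (T j j)%:P) %| q - ((T j j)^*)%:P.
      by apply: dvdp_trans (qP _ Tj); rewrite addSn exprS dvdp_mulIl.
    by rewrite dvdp_XsubCl rootE !hornerE subr_eq0 => /eqP.
  have /eqP := tr0; rewrite psumr_eq0 => [/allP/(_ i (mem_index_enum i))|j _].
    by rewrite /= hornerM hornerX qT mul_conjC_eq0 => /eqP.
  by rewrite hornerM hornerX qT mul_conjC_ge0.
have := annA _ (dvdpp _); rewrite charT (eq_big_seq (fun=> 'X)).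
  by rewrite big_const_seq count_predT tsz iter_mulr_1 rmorphXn /= horner_mx_X.
by move=> l /mapP[i _ ->]; rewrite T0 subr0.
Qed.

End ConjugateSemisimplePart.

(** * Derivations, traces and Engel's theorem *)

Section LieBasics.
Variables (F : fieldType) (g : lieAlgType F).
Implicit Types (x y z u v : g) (f h d : 'End(g)).

Lemma lieDl x y z : lie (x + y) z = lie x z + lie y z.
Proof. by rewrite -!adrE linearD. Qed.

Lemma lieDr x y z : lie x (y + z) = lie x y + lie x z.
Proof. by rewrite -!adE linearD. Qed.

Lemma lieZl c x y : lie (c *: x) y = c *: lie x y.
Proof. by rewrite -!adrE linearZ. Qed.

Lemma lieZr c x y : lie x (c *: y) = c *: lie x y.
Proof. by rewrite -!adE linearZ. Qed.

Lemma lie0l x : lie 0 x = 0.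
Proof. by rewrite -adrE linear0. Qed.

Lemma lie0r x : lie x 0 = 0.
Proof. by rewrite -adE linear0. Qed.

Lemma lieNr x y : lie x (- y) = - lie x y.
Proof. by rewrite -!adE linearN. Qed.

Lemma lieC x y : lie x y = - lie y x.
Proof.
apply/eqP; rewrite -addr_eq0; apply/eqP.
by have := lie_alt (x + y); rewrite lieDl !lieDr !lie_alt add0r addr0.
Qed.

Lemma lie_lie x y z : lie x (lie y z) = lie (lie x y) z + lie y (lie x z).
Proof.
have /eqP := lie_jacobi x y z; rewrite -addrA addr_eq0 => /eqP ->.
by rewrite opprD addrC [lie z _]lieC opprK [lie z x]lieC lieNr opprK.
Qed.

Lemma endtraceD f h : endtrace (f + h) = endtrace f + endtrace h.
Proof.
by rewrite /endtrace -[f in LHS]scale1r passmx.mxof_linear scale1r mxtraceD.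
Qed.

Lemma endtraceZ c f : endtrace (c *: f) = c * endtrace f.
Proof.
rewrite /endtrace -[_ *: f]addr0 passmx.mxof_linear mxtraceD mxtraceZ.
have -> : passmx.mxof (vbasis {:g}) (vbasis {:g}) (0 : 'End(g)) = 0.
  by apply/eqP; rewrite passmx.mxof_eq0 ?vbasisP.
by rewrite mxtrace0 addr0.
Qed.

Lemma endtraceB f h : endtrace (f - h) = endtrace f - endtrace h.
Proof. by rewrite endtraceD -scaleN1r endtraceZ mulN1r. Qed.

Lemma endtraceC f h : endtrace (f \o h)%VF = endtrace (h \o f)%VF.
Proof.
have bB : basis_of {:g} (vbasis {:g}) := vbasisP _.
by rewrite /endtrace !(passmx.mxof_comp _ _ bB) mxtrace_mulC.
Qed.

Definition derivation d : Prop :=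
  forall x y, d (lie x y) = lie (d x) y + lie x (d y).

Lemma ad_derivation x : derivation (ad x).
Proof. by move=> y z; rewrite !adE lie_lie. Qed.

Lemma derivation_ad d x : derivation d ->
  ad (d x) = ((d \o ad x) - (ad x \o d))%VF.
Proof.
move=> dD; apply/lfunP=> y.
by rewrite add_lfunE opp_lfunE !comp_lfunE !adE dD addrK.
Qed.

Lemma ad_lie x y : ad (lie x y) = ((ad x \o ad y) - (ad y \o ad x))%VF.
Proof. by rewrite -(derivation_ad _ (ad_derivation x)) adE. Qed.

Lemma comp_lfunBl f h d : ((f - h) \o d = (f \o d) - (h \o d))%VF.
Proof. by rewrite comp_lfunDl comp_lfunNl. Qed.

Lemma comp_lfunBr f h d : (f \o (h - d) = (f \o h) - (f \o d))%VF.
Proof. by rewrite comp_lfunDr comp_lfunNr. Qed.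

(** Cyclicity of the trace turns tr([ad x, ad y] d) into tr(ad x [ad y, d]), and [ad y, d] = - ad (d
    y) for a derivation. *)
Lemma endtrace_ad_lie d x y : derivation d ->
  endtrace (ad (lie x y) \o d)%VF = - killing x (d y).
Proof.
move=> dD; rewrite /killing (derivation_ad _ dD) ad_lie comp_lfunBl comp_lfunBr.
rewrite !endtraceB opprB !comp_lfunA; congr (_ - _).
by rewrite -comp_lfunA endtraceC.
Qed.

Lemma killingDl x y z : killing (x + y) z = killing x z + killing y z.
Proof. by have := killing_linearl z 1 x y; rewrite !scale1r. Qed.

Lemma killingDr x y z : killing x (y + z) = killing x y + killing x z.
Proof. by rewrite !(killingC x) killingDl. Qed.

Lemma killing0l x : killing 0 x = 0.
Proof. by have := killingDl 0 0 x; rewrite addr0 => /eqP; rewrite -subr_eq subrr => /eqP. Qed.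

Lemma killingNl x y : killing (- x) y = - killing x y.
Proof. by apply/eqP; rewrite -addr_eq0 -killingDl addNr killing0l. Qed.

(** Invariance of the Killing form is [endtrace_ad_lie] for the inner derivation [ad z]. *)
Lemma killing_lie x y z : killing (lie x y) z = killing x (lie y z).
Proof.
rewrite [LHS](endtrace_ad_lie _ _ (ad_derivation z)) adE.
by rewrite [RHS]killingC [lie y z]lieC killingNl [in RHS]killingC.
Qed.

Lemma iter_lfun0 f k : iter k f 0 = 0.
Proof. by elim: k => //= k ->; rewrite linear0. Qed.

Lemma iter_lfunD f k x y : iter k f (x + y) = iter k f x + iter k f y.
Proof. by elim: k => //= k ->; rewrite linearD. Qed.

(** By the Leibniz rule, d - (l + m) acts on [x, y] as d - l on x plus d - m on y, so each resulting
    term lowers [p] or [q]; the induction is on their sum. *)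
Lemma iter_shift_derivation_lie d l m p q x y : derivation d ->
  iter p (d - l *: \1%VF) x = 0 -> iter q (d - m *: \1%VF) y = 0 ->
  iter (p + q) (d - (l + m) *: \1%VF) (lie x y) = 0.
Proof.
move=> dD; move: {2}(p + q)%N (erefl (p + q)%N) => k.
elim: k p q x y => [|k IH] [|p] [|q] x y //=.
- by move=> _ -> _; rewrite lie0l.
- by move=> _ -> _; rewrite lie0l -iterS iter_lfun0.
- by move=> _ _ ->; rewrite lie0r -iterS iter_lfun0.
rewrite addSn => -[kE]; rewrite -!iterS !iterSr => x0 y0.
have -> : (d - (l + m) *: \1)%VF (lie x y) =
    lie ((d - l *: \1)%VF x) y + lie x ((d - m *: \1)%VF y).
  rewrite !add_lfunE !opp_lfunE !scale_lfunE !id_lfunE dD lieDl lieDr.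
  rewrite -!scaleNr lieZl lieZr opprD scalerDl addrACA.
  by congr (_ + _).
rewrite iter_lfunD IH ?add0r //; last by rewrite iterSr.
by rewrite addnS -addSn in kE *; rewrite IH // iterSr.
Qed.

End LieBasics.

Section Engel.
Variables (F : fieldType) (g : lieAlgType F).
Implicit Types (x y v : g) (L A B : {vspace g}).

Definition ad_stable L A : Prop := forall x y, x \in L -> y \in A -> lie x y \in A.

Definition ad_nilpotent x : Prop := exists k, forall y, iter k (lie x) y = 0.

Lemma subalgebra_add_line L y : lie_subalgebra L ->
  (forall x, x \in L -> lie x y \in L) -> lie_subalgebra (L + <[y]>)%VS.
Proof.
move=> Ls Ly p q /memv_addP[u uL [w /vlineP[c ->] ->]].
move=> /memv_addP[v vL [w' /vlineP[k ->] ->]].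
apply: (subvP (addvSl L <[y]>)).
rewrite lieDl !lieDr !lieZl !lieZr lie_alt !scaler0.
apply: rpredD; apply: rpredD; [exact: Ls| | |by rewrite mem0v].
  by rewrite rpredZ // Ly.
by rewrite rpredZ // lieC rpredN Ly.
Qed.

(** Engel's theorem in relative form: the pair [A], [B] stands for the module B / (A ∩ B). The
    induction can then use [L] modulo a subalgebra as a module. *)
Lemma engel (L : {vspace g}) : lie_subalgebra L -> (forall x, x \in L -> ad_nilpotent x) ->
  forall A B, ad_stable L A -> ad_stable L B -> ~~ (B <= A)%VS ->
  exists v, [/\ v \in B, v \notin A & forall x, x \in L -> lie x v \in A].
Proof.
have [k] := ubnP (\dim L); elim: k L => // k IH L dL Ls Ln A B LA LB BA.
have [L0|Lnz] := eqVneq L 0%VS.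
  have /subvPn[v vB vA] := BA; exists v; split=> // x.
  by rewrite L0 memv0 => /eqP->; rewrite lie0l mem0v.
(* A proper subalgebra [M] acts on [L] modulo [M], and the induction hypothesis gives [y] outside
   [M] normalising it. Adding such lines until [L] is reached yields an ideal [N] of codimension
   one. *)
have codim1 M : (M <= L)%VS -> ~~ (L <= M)%VS -> lie_subalgebra M ->
    exists N y, [/\ (N <= L)%VS, ~~ (L <= N)%VS, lie_subalgebra N,
      L = (N + <[y]>)%VS & forall x, x \in N -> lie x y \in N].
  have [m] := ubnP (\dim L - \dim M)%N; elim: m M => // m IHm M dM ML LM Ms.
  have dML : (\dim M < \dim L)%N.
    by rewrite (ltn_leqif (dimv_leqif_sup ML)).
  have [|x xM|||y [yL yM My]] := IH M _ Ms _ M L _ _ LM.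
  - exact: leq_trans dML _.
  - by apply/Ln/(subvP ML).
  - by [].
  - by move=> x z /(subvP ML); apply: Ls.
  have NL : (M + <[y]> <= L)%VS by rewrite subv_add ML.
  have [LN|LN] := boolP (L <= M + <[y]>)%VS.
    by exists M, y; split=> //; apply/eqP; rewrite eqEsubv LN.
  apply: (IHm (M + <[y]>)%VS) => //; last exact: subalgebra_add_line.
  have dN : (\dim (M + <[y]>) < \dim L)%N by rewrite (ltn_leqif (dimv_leqif_sup NL)).
  have dMN : (\dim M < \dim (M + <[y]>))%N.
    rewrite (ltn_leqif (dimv_leqif_sup (addvSl _ _))).
    by rewrite subv_add subvv.
  by rewrite -ltnS; apply: leq_trans dM; rewrite ltnS ltn_sub2l.
have [||x y|N [y [NL LN Ns LE Ny]]] := codim1 0%VS; rewrite ?sub0v ?subv0 //.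
  by rewrite !memv0 => /eqP-> /eqP->; rewrite lie0l.
have yL : y \in L by rewrite LE; apply: (subvP (addvSr _ _)); apply: memv_line.
have dNL : (\dim N < \dim L)%N by rewrite (ltn_leqif (dimv_leqif_sup NL)).
have [|x xN|x z xN|x z xN|v [vB vA Nv]] := IH N _ Ns _ A B _ _ BA.
- exact: leq_trans dNL _.
- by apply/Ln/(subvP NL).
- by apply: LA; apply: (subvP NL).
- by apply: LB; apply: (subvP NL).
(* Bracketing with [y] preserves the vectors that [N] sends into [A], because [N, y] lies in [N]. *)
have itP j : iter j (lie y) v \in B /\
    forall x, x \in N -> lie x (iter j (lie y) v) \in A.
  elim: j => //= j [wB wA]; split=> [|x xN]; first exact: LB.
  by rewrite lie_lie rpredD ?wA ?Ny // LA // wA.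
have [j jP] := Ln y yL.
have exj : exists j, iter j (lie y) v \in A by exists j; rewrite jP mem0v.
(* The last iterate before entering [A] is sent into [A] by both [N] and [y]. *)
case: (ex_minnP exj) => -[|i] iA imin; first by rewrite /= (negPf vA) in iA.
exists (iter i (lie y) v); have [wB wA] := itP i; split=> //.
  by apply/negP=> /imin; rewrite ltnn.
move=> x; rewrite LE => /memv_addP[u uN [w /vlineP[c ->] ->]].
by rewrite lieDl lieZl; apply: rpredD; rewrite ?wA ?rpredZ.
Qed.

(** Engel's theorem with A = 0 and B = g gives a nonzero central vector. Its line is an ideal, hence
    all of g, which would make g abelian. *)
Lemma lie_simple_not_nil : lie_simple g -> ~ forall x, ad_nilpotent x.
Proof.
move=> [[a [b ab]] simp] nil.
have fN : ~~ ({:g} <= 0)%VS.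
  by apply/subvPn; exists (lie a b); rewrite ?memvf // memv0.
have [||||v [_ v0 vP]] := @engel {:g}%VS _ _ 0%VS {:g}%VS _ _ fN.
- by move=> *; apply: memvf.
- by move=> x _; apply: nil.
- by move=> x y _; rewrite memv0 => /eqP->; rewrite lie0r mem0v.
- by move=> *; apply: memvf.
have {}vP x : lie x v = 0 by apply/eqP; rewrite -memv0 vP ?memvf.
have [x y /vlineP[c ->]|/eqP|lf] := simp <[v]>%VS.
- by rewrite lieZr vP scaler0 mem0v.
- by rewrite -subv0 -memvE (negPf v0).
have /vlineP[c bE] : b \in <[v]>%VS by rewrite lf memvf.
by rewrite bE lieZr vP scaler0 eqxx in ab.
Qed.

End Engel.

(** * Cartan's criterion *)

Section CartanCriterion.
Variables (K : numClosedFieldType) (g : lieAlgType K).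
Implicit Types (x y z : g) (d : 'End(g)).

(** The linear form x -> tr(ad x d) kills all brackets by [endtrace_ad_lie], so its kernel is a
    nonzero ideal. *)
Lemma endtrace_ad_derivation d : lie_simple g -> derivation d ->
  (forall x y, killing x y = 0) -> forall x, endtrace (ad x \o d)%VF = 0.
Proof.
move=> [[a [b ab]] simp] dD k0.
have Tlin : linear (fun x => endtrace (ad x \o d)%VF : K^o).
  move=> c x y; have -> : ad (c *: x + y) = c *: ad x + ad y.
    by apply/lfunP=> z; rewrite add_lfunE scale_lfunE !adE lieDl lieZl.
  by rewrite comp_lfunDl -comp_lfunZl endtraceD endtraceZ.
pose T : {linear g -> K^o} := HB.pack (fun x => endtrace (ad x \o d)%VF : K^o)
  (GRing.isSemilinear.Build _ _ _ _ _ (GRing.semilinear_linear Tlin)).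
have kerT x : (x \in lker (linfun T)) = (endtrace (ad x \o d)%VF == 0).
  by rewrite memv_ker lfunE.
have lieT x y : lie x y \in lker (linfun T).
  by rewrite kerT endtrace_ad_lie // k0 oppr0.
move=> x; apply/eqP; rewrite -kerT.
have [y z _|l0|->] := simp (lker (linfun T)); [exact: lieT| |exact: memvf].
by have := lieT a b; rewrite l0 memv0 (negPf ab).
Qed.

(* Acting on each generalised eigenspace of [ad x] by the conjugate of the
   eigenvalue is a derivation, because conjugation is additive; its trace
   against [ad x] is the sum of the squared moduli of the eigenvalues. *)
Lemma ad_nilpotent_of_killing0 : lie_simple g ->
  (forall x y, killing x y = 0) -> forall x, ad_nilpotent x.
Proof.
move=> simp k0 x; set b := vbasis {:g}.
have bB : basis_of {:g} b := vbasisP _.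
set A := passmx.mxof b b (ad x).
have [s [gen Bex]] := conj_semisimple_part A.
have vecofP c u v : passmx.vecof b (c *: u + v) =
    c *: passmx.vecof b u + passmx.vecof b v by exact: passmx.vecof_linear.
have vecof0 : passmx.vecof b 0 = 0 by apply/eqP; rewrite passmx.vecof_eq0.
have iterE l k v : passmx.rVof b (iter k (ad x - l *: \1%VF) v) =
    passmx.rVof b v *m (A - l%:M) ^+ k.
  elim: k => [|k IH]; first by rewrite expr0 mulmx1.
  rewrite /= exprSr mulmxA -IH (passmx.rVof_app _ bB); congr (_ *m _).
  rewrite -[ad x - _]addrC -scaleNr passmx.mxof_linear passmx.mxof1; last first.
    exact: basis_free bB.
  by rewrite scaleNr scalemx1 addrC.
have eigenE l k v : passmx.rVof b v *m (A - l%:M) ^+ k = 0 ->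
    iter k (ad x - l *: \1%VF) v = 0.
  by rewrite -iterE => /eqP; rewrite passmx.rVof_eq0 // => /eqP.
(* Sums of eigenvalues are included so that [d] is also known on brackets of generalised
   eigenvectors. *)
pose S := s ++ [seq l + m | l <- s, m <- s].
have [|B [BP trP]] := Bex S; first by move=> l ls; rewrite mem_cat ls.
pose d := passmx.hommx b b B.
have dE l v : l \in S ->
    iter (\dim {:g} + \dim {:g}) (ad x - l *: \1%VF) v = 0 -> d v = l^* *: v.
  move=> lS v0; rewrite /d passmx.hommxE // (BP l) //.
    by rewrite -[_ *: _]addr0 vecofP vecof0 addr0 passmx.rVofK.
  by rewrite -iterE v0; apply/eqP; rewrite passmx.rVof_eq0.
have dE1 l v : l \in s -> iter (\dim {:g}) (ad x - l *: \1%VF) v = 0 ->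
    d v = l^* *: v.
  move=> ls v0; apply: dE; first by rewrite mem_cat ls.
  by rewrite iterD v0 iter_lfun0.
have genP (Q : g -> Prop) : (forall u v, Q u -> Q v -> Q (u + v)) -> Q 0 ->
    (forall l v, l \in s -> iter (\dim {:g}) (ad x - l *: \1%VF) v = 0 -> Q v) ->
    forall v, Q v.
  move=> QD Q0 Ql v; rewrite -[v](passmx.rVofK bB).
  apply: (gen (fun r => Q (passmx.vecof b r))) => [u w Qu Qw||l w ls w0].
  - by rewrite -[u]scale1r vecofP scale1r; apply: QD.
  - by rewrite vecof0.
  - by apply: (Ql l) => //; apply: eigenE; rewrite passmx.vecofK.
have dD : derivation d.
  move=> u v; move: u.
  apply: (genP _) => [u w Hu Hw||l u ls u0].
  - by rewrite !(linearD, lieDl) /= Hu Hw addrACA.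
  - by rewrite linear0 !lie0l linear0 addr0.
  move: v; apply: (genP _) => [v w Hv Hw||m v ms v0].
  - by rewrite !(linearD, lieDr) /= Hv Hw addrACA.
  - by rewrite linear0 !lie0r linear0 addr0.
  rewrite (dE1 l u) // (dE1 m v) // lieZl lieZr -scalerDl -rmorphD.
  apply: dE; first by rewrite mem_cat allpairs_f ?orbT.
  exact: iter_shift_derivation_lie (ad_derivation x) u0 v0.
have A0 : A ^+ \dim {:g} = 0.
  apply: trP; rewrite mxtrace_mulC -(passmx.hommxK bB bB B) -passmx.mxof_comp //.
  exact: endtrace_ad_derivation.
exists (\dim {:g}) => y; rewrite (@eq_iter _ _ (ad x - 0 *: \1%VF)) => [|z].
  by apply: eigenE; rewrite raddf0 subr0 A0 mulmx0.
by rewrite scale0r subr0 adE.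
Qed.

(** The radical is an ideal by invariance. If it were all of g, every [ad x] would be nilpotent,
    against Engel's theorem. *)
Lemma killing_nondegenerate : lie_simple g -> killing_perp {:g} = 0%VS.
Proof.
move=> simp; have [|//|rad] := simp.2 (killing_perp {:g}).
  move=> x y /killing_perpP yP; apply/killing_perpP=> z _.
  by rewrite lieC killingNl killing_lie yP ?oppr0 ?memvf.
case: (lie_simple_not_nil simp); apply: ad_nilpotent_of_killing0 => // x y.
have /killing_perpP/(_ y (memvf y)) // : x \in killing_perp {:g}.
by rewrite rad memvf.
Qed.

End CartanCriterion.

(** * The alternating form [omega] and its orthogonals *)

Section OmegaForm.
Variables (K : numClosedFieldType) (g : lieAlgType K) (e : g).
Hypothesis simp : lie_simple g.
Implicit Types (x y z : g) (U V A B : {vspace g}).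

Local Notation Z := (lie_centralizer e).

Definition omega x y := killing x (lie y e).

Definition omega_perp U : {vspace g} := killing_perp (adr e @: U).

Lemma omega_perpP U x :
  reflect (forall y, y \in U -> omega x y = 0) (x \in omega_perp U).
Proof.
apply: (iffP (killing_perpP _ _)) => [xU y yU|xU _ /memv_imgP[y yU ->]].
  by rewrite /omega -adrE xU // memv_img.
by rewrite adrE -/(omega x y) xU.
Qed.

Lemma omegaE x y : omega x y = killing (lie x y) e.
Proof. by rewrite killing_lie. Qed.

Lemma omegaC x y : omega x y = - omega y x.
Proof. by rewrite !omegaE lieC killingNl. Qed.

Lemma mem_centralizer x : (x \in Z) = (lie x e == 0).
Proof. by rewrite memv_ker adE lieC oppr_eq0. Qed.

(** The hypothesis makes [x, e] orthogonal to all of g, hence zero by nondegeneracy of the Killing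
    form. *)
Lemma omega_radical x : (forall y, omega x y = 0) -> x \in Z.
Proof.
move=> x0; rewrite mem_centralizer -memv0 -(killing_nondegenerate simp).
by apply/killing_perpP=> y _; rewrite killingC -/(omega y x) omegaC x0 oppr0.
Qed.

Lemma omega_perp_sym A B : (A <= omega_perp B)%VS -> (B <= omega_perp A)%VS.
Proof.
move=> /subvP AB; apply/subvP=> y yB; apply/omega_perpP=> x xA.
by rewrite omegaC; have /omega_perpP-> := AB x xA; rewrite ?oppr0.
Qed.

Lemma omega_perpS A B : (A <= B)%VS -> (omega_perp B <= omega_perp A)%VS.
Proof.
move=> /subvP AB; apply/subvP=> x /omega_perpP xB; apply/omega_perpP=> y /AB.
exact: xB.
Qed.

Lemma omega_perpD A B : omega_perp (A + B) = (omega_perp A :&: omega_perp B)%VS.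
Proof.
apply/eqP; rewrite eqEsubv subv_cap !omega_perpS ?addvSl ?addvSr //=.
by apply: omega_perp_sym; rewrite subv_add; apply/andP; split;
  apply: omega_perp_sym; rewrite ?capvSl ?capvSr.
Qed.

Lemma centralizer_omega_perp U : (Z <= omega_perp U)%VS.
Proof.
apply: omega_perp_sym; apply/subvP=> x _; apply/omega_perpP=> z.
by rewrite mem_centralizer /omega => /eqP->; rewrite killingC killing0l.
Qed.

Lemma omega_perpDZ U : omega_perp (U + Z) = omega_perp U.
Proof.
rewrite omega_perpD; apply/capv_idPl; apply: omega_perp_sym.
exact: centralizer_omega_perp.
Qed.

Lemma omega_perp_line x : (<[x]> <= omega_perp <[x]>)%VS.
Proof.
apply/subvP=> _ /vlineP[c ->]; apply/memvZ/omega_perpP=> _ /vlineP[k ->].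
by rewrite omegaE lieZr lie_alt scaler0 killing0l.
Qed.

(** Each vector of a basis of [B] imposes one linear condition on [A]. *)
Lemma dim_killing_perp_geq A B :
  (\dim A <= \dim B + \dim (A :&: killing_perp B))%N.
Proof.
suff gen (s : seq g) : (\dim A <= size s + \dim (A :&:
    \bigcap_(y <- s) lker (linfun ((fun x => killing x y) : g -> K^o))))%N.
  by have := gen (vbasis B); rewrite size_tuple.
elim: s => [|y s IH]; first by rewrite big_nil capvf.
rewrite big_cons /= addSn -addnS; apply: leq_trans IH _; rewrite leq_add2l.
set f := linfun _; set X := (\bigcap_(_ <- s) _)%VS.
rewrite -(limg_ker_dim f (A :&: X)) -capvA [(X :&: _)%VS]capvC -addn1 leq_add2l.
by rewrite (leq_trans (dimvS (subvf _))) // dimvf.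
Qed.

Lemma dim_killing_perp U : (\dim U + \dim (killing_perp U) = \dim {:g})%N.
Proof.
apply/eqP; rewrite eqn_leq; apply/andP; split; last first.
  by have := dim_killing_perp_geq {:g} U; rewrite capfv.
(* A vector orthogonal to both [U] and a complement is in the radical, so the orthogonal of [U] is
   no larger than that complement. *)
have := dim_killing_perp_geq (killing_perp U) U^C.
suff -> : (killing_perp U :&: killing_perp U^C = 0)%VS.
  by rewrite dimv0 addn0 dimv_compl leq_subRL ?dimvS ?subvf.
apply/eqP; rewrite -subv0 -(killing_nondegenerate simp).
apply/subvP=> x /memv_capP[/killing_perpP xU /killing_perpP xC].
apply/killing_perpP=> y _; have : y \in (U + U^C)%VS by rewrite addv_complf memvf.
by case/memv_addP=> u /xU u0 [v /xC v0 ->]; rewrite killingDr u0 v0 addr0.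
Qed.

(** Bracketing with [e] is injective on such a [U], so [U, e] has the dimension of [U]. *)
Lemma dim_omega_perp U : (U :&: Z = 0)%VS ->
  (\dim U + \dim (omega_perp U) = \dim {:g})%N.
Proof.
move=> UZ; rewrite -[RHS](dim_killing_perp (adr e @: U)) limg_dim_eq //.
rewrite -UZ; congr (_ :&: _)%VS; apply/vspaceP=> x.
by rewrite mem_centralizer memv_ker adrE.
Qed.

Lemma mem_omega_perp_killing m x : (x \in omega_perp m) = (lie x e \in killing_perp m).
Proof.
have kE y : killing (lie x e) y = - omega x y.
  by rewrite killing_lie lieC killingC killingNl killingC.
apply/omega_perpP/killing_perpP=> xm y /xm.
  by rewrite kE => ->; rewrite oppr0.
by rewrite kE => /eqP; rewrite oppr_eq0 => /eqP.
Qed.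

(** Condition (A3) read through x -> [x, e], whose kernel is g^e: the preimage of the Killing
    orthogonal of [m] is its [omega]-orthogonal, and that of [n, e] is n + g^e. *)
Lemma killing_perp_commutatorP m n :
  (killing_perp m :&: (adr e @: {:g}))%VS = (adr e @: n)%VS <->
  omega_perp m = (n + Z)%VS.
Proof.
split=> [mn|mn]; apply/vspaceP=> x.
  rewrite mem_omega_perp_killing -adrE.
  have -> : (adr e x \in killing_perp m) = (adr e x \in (adr e @: n)%VS).
    by rewrite -mn memv_cap memv_img ?memvf ?andbT.
  apply/memv_imgP/memv_addP=> [[y yn /eqP]|[y yn [z zZ ->]]].
    rewrite -subr_eq0 -linearB /= adrE -mem_centralizer => zZ.
    by exists y => //; exists (x - y); rewrite // addrC subrK.
  by exists y => //; move: zZ; rewrite mem_centralizer -adrE linearD /= => /eqP->; rewrite addr0.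
apply/memv_capP/memv_imgP=> [[xm /memv_imgP[y _ xE]]|[y yn ->]].
  have : y \in omega_perp m by rewrite mem_omega_perp_killing -adrE -xE.
  rewrite mn => /memv_addP[u un [z zZ yE]]; exists u => //.
  move: zZ; rewrite mem_centralizer -adrE => /eqP z0.
  by rewrite xE yE linearD /= z0 addr0.
split; last by rewrite memv_img ?memvf.
by rewrite adrE -mem_omega_perp_killing mn (subvP (addvSl _ _)).
Qed.

End OmegaForm.

(** * Gradings *)

Section Gradings.
Variables (K : numClosedFieldType) (g : lieAlgType K) (G : grading g).
Implicit Types (x y z : g) (U V A B T : {vspace g}) (i j k : int).

Lemma subv_big_seq (s : seq int) (p : pred int) (Us : int -> {vspace g}) T :
  (forall i, p i -> (Us i <= T)%VS) -> (\sum_(i <- s | p i) Us i <= T)%VS.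
Proof.
move=> UT; apply: (big_ind (fun U => U <= T)%VS) => // [|U V UT' VT].
  exact: sub0v.
by rewrite subv_add UT'.
Qed.

Lemma gpart_sub_sum j (p : pred int) : p j -> (G j <= \sum_(i <- gsupp G | p i) G i)%VS.
Proof.
move=> pj; have [js|js] := boolP (j \in gsupp G); last by rewrite gpart0 ?sub0v.
by rewrite (big_rem j) //= pj addvSl.
Qed.

Lemma full_sub T : (forall j, (G j <= T)%VS) -> T = {:g}%VS.
Proof.
move=> GT; apply/eqP; rewrite eqEsubv subvf -(gpart_full G).
exact: subv_big_seq.
Qed.

(** Directness is carried as an equality of dimensions, which passes to the tail of the list:
    subadditivity forces [G j] to meet the sum of the others trivially. [D] is assembled from the
    two projections. *)
Lemma weighted_sum_projections (s : seq int) (c : int -> K) : uniq s ->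
  \dim (\sum_(j <- s) G j) = \sum_(j <- s) \dim (G j) ->
  exists D : 'End(g), forall j x, j \in s -> x \in G j -> D x = c j *: x.
Proof.
elim: s => [|j s IH]; first by exists 0.
rewrite cons_uniq !big_cons => /andP[js us] dE; set S := (\sum_(i <- s) G i)%VS.
have dS : (\dim S <= \sum_(i <- s) \dim (G i))%N.
  rewrite /S; elim: (s) => [|i r IHr]; first by rewrite !big_nil dimv0.
  by rewrite !big_cons (leq_trans (dimv_add_leqif _ _)) // leq_add2l.
have dc := dimv_sum_cap (G j) S; rewrite dE in dc.
have cap0 : (G j :&: S = 0)%VS.
  apply/eqP; rewrite -dimv_eq0 -leqn0 -(leq_add2l (\sum_(i <- s) \dim (G i))).
  by rewrite addn0 -(leq_add2l (\dim (G j))) addnA dc leq_add2l.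
have [|D DP] := IH us.
  by apply/eqP; rewrite -(eqn_add2l (\dim (G j))) -dc cap0 dimv0 addn0.
exists (c j *: daddv_pi (G j) S + (D \o daddv_pi S (G j))%VF) => i x ijs xi.
rewrite add_lfunE scale_lfunE comp_lfunE.
move: ijs; rewrite inE => /orP[/eqP ij|is_].
  rewrite ij in xi *.
  have xGS : x \in (G j + S)%VS by apply: (subvP (addvSl _ _)).
  have := daddv_pi_add cap0 xGS; rewrite daddv_pi_id //.
  by move/(canRL (addKr x)); rewrite addNr => ->; rewrite linear0 addr0.
have xS : x \in S by apply: (subvP _ _ xi); rewrite /S (big_rem i) //= addvSl.
have xGS : x \in (G j + S)%VS by apply: (subvP (addvSr _ _)).
have cap0' : (S :&: G j = 0)%VS by rewrite capvC.
have := daddv_pi_add cap0 xGS; rewrite (daddv_pi_id cap0') //.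
by move/(canRL (addrK x)); rewrite subrr => ->; rewrite scaler0 add0r (DP i).
Qed.

(** Two weights are used below: the indicator of a degree, giving a projection, and the degree
    itself, giving the grading derivation. *)
Lemma weighted_projections (c : int -> K) :
  exists D : 'End(g), forall j x, x \in G j -> D x = c j *: x.
Proof.
have [|D DP] := weighted_sum_projections c (gsupp_uniq G).
  by have := gpart_direct G; rewrite directvE /= => /eqP.
exists D => j x xj; have [js|js] := boolP (j \in gsupp G); first exact: DP xj.
by move: xj; rewrite gpart0 // memv0 => /eqP->; rewrite linear0 scaler0.
Qed.

Lemma gpart_disjoint j x (p : pred int) : ~~ p j -> x \in G j ->
  x \in (\sum_(i <- gsupp G | p i) G i)%VS -> x = 0.
Proof.
move=> pj xj xS; have [D DP] := weighted_projections (fun i => (i == j)%:R).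
suff SD : (\sum_(i <- gsupp G | p i) G i <= lker D)%VS.
  by move: (subvP SD _ xS); rewrite memv_ker (DP j) // eqxx scale1r => /eqP.
apply: subv_big_seq => i pi; apply/subvP=> y /DP; rewrite memv_ker => ->.
have /negPf-> : i != j by apply: contraNneq pj => <-.
by rewrite scale0r.
Qed.

Lemma gpart_inj_degree i j x : x \in G i -> x \in G j -> x != 0 -> i = j.
Proof.
move=> xi xj x0; have [D DP] := weighted_projections (fun k => k%:~R).
have := DP i x xi; rewrite (DP j) // => /eqP; rewrite -subr_eq0 -scalerBl.
by rewrite scaler_eq0 (negPf x0) orbF subr_eq0 eqr_int => /eqP.
Qed.

(* The trace of [[D, f]] vanishes, while [[D, f] = (i + j) f] for the grading
   derivation [D] and [f = ad x \o ad y]. *)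
Lemma killing_gpart i j x y : x \in G i -> y \in G j -> i + j != 0 ->
  killing x y = 0.
Proof.
move=> xi yj ij; have [D DP] := weighted_projections (fun k => k%:~R).
set f := (ad x \o ad y)%VF.
have Df : ((D \o f) - (f \o D))%VF = (i + j)%:~R *: f.
  apply/lfunP=> u; have /subvP/(_ u (memvf u)) : ({:g} <= lker ((D \o f) -
      (f \o D) - (i + j)%:~R *: f)%VF)%VS.
    rewrite (full_sub (T := lker _)) // => k; apply/subvP=> v vk.
    rewrite memv_ker !(add_lfunE, opp_lfunE, scale_lfunE, comp_lfunE) !adE.
    have fv : lie x (lie y v) \in G (i + (j + k)) by rewrite !gpart_lie.
    rewrite (DP _ _ fv) (DP _ _ vk) !lieZr addrA !intrD scalerDl addrK subrr.
    by [].
  by rewrite memv_ker !(add_lfunE, opp_lfunE) subr_eq0 => /eqP.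
have /eqP := congr1 (@endtrace _ _) Df.
rewrite endtraceB endtraceC subrr endtraceZ eq_sym mulf_eq0 intr_eq0.
by rewrite (negPf ij) => /eqP.
Qed.

Lemma lie_gpart_sum (p q : pred int) T :
  (forall i j, p i -> q j -> (G (i + j)%R <= T)%VS) ->
  forall x y, x \in (\sum_(i <- gsupp G | p i) G i)%VS ->
    y \in (\sum_(j <- gsupp G | q j) G j)%VS -> lie x y \in T.
Proof.
(* The preimage of [T] under a linear map is a subspace, so each argument in turn may be taken
   homogeneous. *)
move=> pqT x y xp yq; rewrite -adrE memv_preim.
apply: (subvP _ _ xp); apply: subv_big_seq => i pi; apply/subvP=> u ui.
rewrite -memv_preim adrE -adE memv_preim.
apply: (subvP _ _ yq); apply: subv_big_seq => j qj; apply/subvP=> v vj.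
by rewrite -memv_preim adE (subvP (pqT i j pi qj)) // gpart_lie.
Qed.

(** Since [omega x y] is the Killing product of [x, y] with [e], degrees i and j pair to zero unless
    i + j + a = 0. *)
Lemma gpart_sum_omega_perp e a A B (p q : pred int) : e \in G a ->
  (A <= \sum_(i <- gsupp G | p i) G i)%VS ->
  (B <= \sum_(j <- gsupp G | q j) G j)%VS ->
  (forall i j, p i -> q j -> i + j + a != 0) ->
  (A <= omega_perp e B)%VS.
Proof.
move=> ea Ap Bq pq; apply: (subv_trans Ap); apply: subv_big_seq => i pi.
apply: omega_perp_sym; apply: (subv_trans Bq); apply: subv_big_seq => j qj.
apply/subvP=> y yj; apply/omega_perpP=> x xi.
rewrite omegaE (killing_gpart (gpart_lie yj xi) ea) //.
by rewrite [j + i]addrC pq.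
Qed.

End Gradings.

(** * Equivalence and exchange of complements *)

Section EquivalentPairs.
Variables (F : fieldType) (g : lieAlgType F) (e : g).
Implicit Types p q r : {vspace g} * {vspace g}.

Lemma equivalent_pairs_refl p : admissible_pair e p -> equivalent_pairs e p p.
Proof. by move=> pP; exists 0%N, (fun=> p); split. Qed.

Lemma comparable_equivalent_pairs p q : comparable_pairs e p q ->
  equivalent_pairs e p q.
Proof.
move=> pq; have [G [pG qG _]] := pq.
exists 1%N, (fun i => if i is 0%N then p else q); split=> // [[|i] _|[|i] //].
  by exists G.
by exists G.
Qed.

Lemma equivalent_pairs_sym p q : equivalent_pairs e p q -> equivalent_pairs e q p.
Proof.
move=> [k [s [s0 sk sadm scmp]]]; exists k, (fun i => s (k - i)%N).
split=> [||i _|i ik]; rewrite ?subn0 ?subnn //; first exact/sadm/leq_subr.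
have := scmp (k - i.+1)%N; rewrite subnSK // leq_subr => /(_ isT)[G [pG qG pq]].
by exists G; split=> //; case: pq; [right|left].
Qed.

Lemma equivalent_pairs_trans q p r : equivalent_pairs e p q ->
  equivalent_pairs e q r -> equivalent_pairs e p r.
Proof.
move=> [k [s [s0 sk sadm scmp]]] [l [t [t0 tl tadm tcmp]]].
exists (k + l)%N, (fun i => if (i <= k)%N then s i else t (i - k)%N).
split=> [||i ikl|i ikl] //.
- case: leqP => [|_]; last by rewrite addKn.
  by rewrite -{2}[k]addn0 leq_add2l leqn0 => /eqP l0; rewrite -tl l0 t0 addn0.
- by case: leqP => [/sadm //|ki]; apply: tadm; rewrite leq_subLR.
have [ik|ki] := ltnP i k; first by rewrite (ltnW ik); apply: scmp.
(* At the junction i = k the two chains agree, as [s k] and [t 0] are the same pair. *)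
rewrite subSn //; have -> : (if (i <= k)%N then s i else t (i - k)%N) = t (i - k)%N.
  by case: leqP => // ik; rewrite (@anti_leq i k) ?ik // subnn t0.
by apply: tcmp; rewrite ltn_subLR.
Qed.

End EquivalentPairs.

Section ComplementExchange.
Variables (F : fieldType) (T : vectType F) (P M Z : {vspace T}).
Implicit Types C H : {vspace T}.

Lemma capv_line0 (U : {vspace T}) x : x \notin U -> (U :&: <[x]> = 0)%VS.
Proof.
move=> xU; apply/eqP; rewrite -subv0; apply/subvP=> z /memv_capP[zU /vlineP[t zE]].
rewrite memv0 zE scaler_eq0; have [//|t0] := eqVneq t 0.
by rewrite zE in zU; move/(memvZ t^-1): zU; rewrite scalerK // (negPf xU).
Qed.

Lemma dim_add_line (U : {vspace T}) x : x \notin U ->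
  \dim (U + <[x]>) = (\dim U).+1.
Proof.
move=> xU; rewrite dimv_disjoint_sum ?capv_line0 // dim_vline.
by case: eqVneq xU => [->|_ _]; rewrite ?mem0v ?addn1.
Qed.

(** By the modular law, the second and third conditions say that [C] and M ∩ Z together span [M]. *)
Definition complement_above C : Prop :=
  [/\ (P <= C)%VS, (C <= M)%VS, (M <= C + Z)%VS & (C :&: Z = 0)%VS].

Lemma complement_above_decomp C : complement_above C ->
  (C + (M :&: Z) = M)%VS /\ \dim M = (\dim C + \dim (M :&: Z))%N.
Proof.
move=> [_ CM MC CZ].
have CE : (C + (M :&: Z) = M)%VS.
  by rewrite capvC vspace_modl //; apply/eqP; rewrite eqEsubv capvSr subv_cap MC /=.
split=> //; rewrite -[in LHS]CE dimv_disjoint_sum //.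
by apply/eqP; rewrite -subv0 -CZ capvS ?capvSr.
Qed.

(** It suffices to add to [A] a complement in [M] of A + (M ∩ Z). *)
Lemma exists_complement_above A : (P <= A)%VS -> (A <= M)%VS -> (A :&: Z = 0)%VS ->
  exists2 C, complement_above C & (A <= C)%VS.
Proof.
move=> PA AM AZ; pose D := (A + (M :&: Z))%VS.
have DM : (D <= M)%VS by rewrite subv_add AM capvSl.
exists (A + (M :\: D))%VS; last exact: addvSl.
split.
- by rewrite (subv_trans PA) // addvSl.
- by rewrite subv_add AM diffvSl.
- rewrite -{1}(addv_diff_cap M D) subv_add (subv_trans (addvSr _ _) (addvSl _ _)).
  rewrite (subv_trans (capvSr _ _)) // subv_add (subv_trans (capvSr _ _) (addvSr _ _)).
  by rewrite (subv_trans (addvSl _ (M :\: D)) (addvSl _ _)).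
apply/eqP; rewrite -subv0; apply/subvP=> x /memv_capP[].
move=> /memv_addP[a aA [d dD ->]] adZ.
have dM : d \in M by apply: (subvP (diffvSl M D)).
have adM : a + d \in M by rewrite memvD // (subvP AM).
have d0 : d = 0.
  apply/eqP; rewrite -memv0 -(capv_diff M D) memv_cap dD /=.
  have -> : d = - a + (a + d) by rewrite addKr.
  by apply: memv_add; rewrite ?memvN // memv_cap adM.
by move: adZ; rewrite d0 addr0 => aZ; rewrite -AZ memv_cap aA.
Qed.

(* Exchanging one basis vector at a time. *)
Lemma complement_above_connected (R : {vspace T} -> {vspace T} -> Prop) :
  (forall C, complement_above C -> R C C) ->
  (forall C1 C2 C3, R C1 C2 -> R C2 C3 -> R C1 C3) ->
  (forall C C' H, complement_above C -> complement_above C' ->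
     (P <= H)%VS -> (H <= C)%VS -> (H <= C')%VS -> \dim C = (\dim H).+1 ->
     R C C') ->
  forall C C', complement_above C -> complement_above C' -> R C C'.
Proof.
move=> Rr Rt Rh C C' CP C'P; have [k] := ubnP (\dim C - \dim (C :&: C'))%N.
elim: k C CP => // k IH C CP dC.
have [CE dM] := complement_above_decomp CP.
have [PC CM _ CZ] := CP; have [PC' C'M MC' C'Z] := C'P.
have [_ dM'] := complement_above_decomp C'P.
have dCC' : \dim C = \dim C'.
  by apply/eqP; rewrite -(eqn_add2r (\dim (M :&: Z))) -dM -dM'.
have [C'C|/subvPn[c' c'C' c'C]] := boolP (C' <= C)%VS.
  have /eqP <- : C' == C by rewrite eqEdim C'C dCC' /=.
  exact: Rr.
(* Modulo [Z], [c'] agrees with a vector [c] of [C], which it will replace. This [c] is not in [C'],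
   for otherwise c' - c would lie in C' ∩ Z = 0. *)
have : c' \in (C + (M :&: Z))%VS by rewrite CE (subvP C'M).
move=> /memv_addP[c cC [y /memv_capP[yM yZ] c'E]].
set I := (C :&: C')%VS.
have cI : c \notin I.
  rewrite memv_cap cC /=; apply/negP=> cC'.
  have : y \in (C' :&: Z)%VS.
    by rewrite memv_cap yZ -[y](addKr c) -c'E memvD ?memvN.
  by rewrite C'Z memv0 => /eqP y0; rewrite c'E y0 addr0 cC in c'C.
(* A hyperplane of [C] containing C ∩ C' and avoiding [c]. *)
pose H := (I + (C :\: (I + <[c]>)))%VS.
have IC : (I <= C)%VS := capvSl _ _.
have HC : (H <= C)%VS by rewrite subv_add IC diffvSl.
have cH : c \notin H.
  apply/negP=> /memv_addP[u uI [d dD cE]].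
  have d0 : d = 0.
    apply/eqP; rewrite -memv0 -(capv_diff C (I + <[c]>)) memv_cap dD /=.
    rewrite -[d](addKr u) -cE.
    by apply: memv_add; rewrite ?memvN ?memv_line.
  by rewrite cE d0 addr0 uI in cI.
have CHc : C = (H + <[c]>)%VS.
  apply/eqP; rewrite eqEsubv subv_add HC -memvE cC !andbT.
  rewrite -{1}(addv_diff_cap C (I + <[c]>)) subv_add.
  rewrite (subv_trans (addvSr I _) (addvSl _ _)) /=.
  by rewrite (subv_trans (capvSr _ _)) // addvS // addvSl.
have c'H : c' \notin H by apply: contraNN c'C; apply/subvP.
pose C1 := (H + <[c']>)%VS.
have PH : (P <= H)%VS by rewrite (subv_trans _ (addvSl _ _)) // subv_cap PC.
have dC1 : \dim C1 = \dim C by rewrite dim_add_line // CHc dim_add_line.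
have C1M : (C1 <= M)%VS.
  by rewrite subv_add (subv_trans HC) // -memvE (subvP C'M).
(* Replacing [c'] by [c] turns a vector of C1 ∩ Z into one of C ∩ Z, which is zero; as [c] is
   outside [H], its coefficient vanishes. *)
have C1Z : (C1 :&: Z = 0)%VS.
  apply/eqP; rewrite -subv0; apply/subvP=> x /memv_capP[].
  move=> /memv_addP[h hH [_ /vlineP[t ->] ->{x}]] xZ.
  have hC := subvP HC _ hH.
  have /eqP : h + t *: c = 0.
    apply/eqP; rewrite -memv0 -CZ memv_cap memvD ?memvZ //=.
    by rewrite -[t *: c](addrK (t *: y)) -scalerDr -c'E addrA memvB // memvZ.
  rewrite addr_eq0 => /eqP hE; have [t0|t0] := eqVneq t 0.
    by rewrite hE t0 !scale0r oppr0 addr0 mem0v.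
  by case/negP: cH; rewrite -[c](scalerK t0) memvZ // -memvN -hE.
have C1P : complement_above C1.
  split=> //; first by rewrite (subv_trans PH) // addvSl.
  suff <- : (C1 + (M :&: Z) = M)%VS by rewrite addvS // capvSr.
  apply/eqP; rewrite eqEdim subv_add C1M capvSl /= dM -dC1.
  rewrite dimv_disjoint_sum // ; apply/eqP; rewrite -subv0 -C1Z capvS // capvSr //.
apply: (Rt _ C1).
  by apply: (Rh _ _ H) => //; [exact: addvSl|rewrite CHc dim_add_line].
apply: IH => //; rewrite -ltnS; apply: leq_trans dC; rewrite ltnS dC1.
apply: ltn_sub2l.
  rewrite (ltn_leqif (dimv_leqif_sup IC)); apply/negP=> /subvP/(_ c cC).
  exact/negP.
(* The intersection with [C'] has gained [c'], so the induction measure drops. *)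
have IC1 : (I + <[c']> <= C1 :&: C')%VS.
  rewrite subv_cap addvS ?addvSl //= subv_add capvSr -memvE c'C' //.
apply: leq_trans (dimvS IC1); rewrite dim_add_line //.
by rewrite memv_cap (negPf c'C).
Qed.

End ComplementExchange.

(** * Admissible pairs *)

Section AdmissiblePairs.
Variables (K : numClosedFieldType) (g : lieAlgType K) (e : g) (G : grading g).
Variables (a b : int).
Hypothesis simp : lie_simple g.
Hypothesis a_gt1 : 1 < a.
Hypothesis e_deg : e \in G a.
Hypothesis e_neq0 : e != 0.
Hypothesis b_gt0 : 0 < b.
Hypothesis b2_le : b *+ 2 <= a.
Implicit Types (x y z : g) (U A B C H m n : {vspace g}).

Local Notation Z := (lie_centralizer e).
Local Notation P := (grading_le G (- a)).
Local Notation N := (grading_lt G 0).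
Local Notation W := (G (b - a)).
Local Notation V := (G (- b)).
Local Notation M := (P + W)%VS.
Local Notation perp := (omega_perp e).

Hypothesis N_decomp : N = (P + (W + V))%VS.

Lemma sub_PN : (P <= N)%VS.
Proof. by rewrite N_decomp addvSl. Qed.

Lemma sub_WN : (W <= N)%VS.
Proof. by rewrite N_decomp (subv_trans (addvSl W V)) ?addvSr. Qed.

Lemma sub_VN : (V <= N)%VS.
Proof. by rewrite N_decomp (subv_trans (addvSr W V)) ?addvSr. Qed.

Lemma sub_MN : (M <= N)%VS.
Proof. by rewrite subv_add sub_PN sub_WN. Qed.

Lemma N_MV : N = (M + V)%VS.
Proof. by rewrite N_decomp addvA. Qed.

Lemma gpart_sub_P j : j <= - a -> (G j <= P)%VS.
Proof. by move=> ja; apply: (@gpart_sub_sum _ _ _ j (fun i => i <= - a)). Qed.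

Lemma lie_NP x y : x \in N -> y \in P -> lie x y \in P.
Proof.
apply: lie_gpart_sum => i j i0 ja; apply: gpart_sub_P; lia.
Qed.

Lemma lie_PN x y : x \in P -> y \in N -> lie x y \in P.
Proof. by move=> xP yN; rewrite lieC memvN lie_NP. Qed.

(** [W, W] has degree 2b - 2a <= -a because 2b <= a, and [V, W] has degree -a. *)
Lemma lie_NM x y : x \in N -> y \in M -> lie x y \in P.
Proof.
move=> xN /memv_addP[p pP [w wW ->]]; rewrite lieDr memvD //; first exact: lie_NP.
move: xN; rewrite N_decomp => /memv_addP[q qP [_ /memv_addP[w' w'W [v vV ->]] ->]].
rewrite !lieDl; apply: memvD; first by rewrite lie_PN // (subvP sub_WN).
apply: memvD.
  by apply: (subvP _ _ (gpart_lie w'W wW)); apply: gpart_sub_P; lia.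
by apply: (subvP _ _ (gpart_lie vV wW)); apply: gpart_sub_P; lia.
Qed.

Lemma lie_MN x y : x \in M -> y \in N -> lie x y \in P.
Proof. by move=> xM yN; rewrite lieC memvN lie_NM. Qed.

Lemma N_sub_perpP : (N <= perp P)%VS.
Proof.
apply: (gpart_sum_omega_perp e_deg (subvv _) (subvv _)) => i j i0 ja; lia.
Qed.

(** The part [v] of degree >= 0 of a vector orthogonal to [P] is still orthogonal to [P], and by
    degrees to everything of degree > -a. It therefore lies in the radical. *)
Lemma perpP : perp P = (N + Z)%VS.
Proof.
apply/eqP; rewrite eqEsubv subv_add N_sub_perpP centralizer_omega_perp !andbT.
apply/subvP=> x xP; have := memvf x; rewrite -(gpart_full G).
rewrite (bigID (fun j => j < 0)) /= => /memv_addP[u uN [v vS xE]].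
rewrite xE memv_add //; apply: omega_radical => // y.
have vP : v \in perp P.
  by rewrite -[v](addKr u) -xE memvD ?memvN // (subvP N_sub_perpP).
suff /subvP/(_ y (memvf y)) : ({:g} <= perp <[v]>)%VS.
  by move/omega_perpP/(_ _ (memv_line v)); rewrite [omega e v y]omegaC => ->; rewrite oppr0.
rewrite -(gpart_full G) (bigID (fun j => j <= - a)) /= subv_add.
rewrite omega_perp_sym -?memvE //=.
apply: (@gpart_sum_omega_perp _ _ G e a _ _ (fun j => ~~ (j <= - a))
  (fun j => ~~ (j < 0)) e_deg (subvv _)) => [|i j /=]; first by rewrite -memvE.
lia.
Qed.

(** In degree -b, [omega] pairs only with degree b - a, that is, with [W]. *)
Lemma V_perpW x : x \in V -> x \in perp W -> x \in Z.
Proof.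
move=> xV xW; apply: omega_radical => // y.
suff gen j : (G j <= perp <[x]>)%VS.
  have := memvf y; rewrite -(full_sub gen) => /omega_perpP/(_ _ (memv_line x)).
  by rewrite [omega e x y]omegaC => ->; rewrite oppr0.
have [->|jW] := eqVneq j (b - a); first by rewrite omega_perp_sym -?memvE.
apply/subvP=> u uj; apply/omega_perpP=> _ /vlineP[c ->].
rewrite omegaE lieZr; apply: (@killing_gpart _ _ G (j - b) a) => //; last lia.
by rewrite memvZ // gpart_lie.
Qed.

(** For a subspace between [P] and [N] this is gradedness: degrees <= -a lie in [P], and only the
    components in [W] and [V] remain to be tested. *)
Definition pieces U : Prop := (U <= P + ((U :&: W) + (U :&: V)))%VS.

Lemma pieces_of_graded U : (U <= N)%VS -> graded_subspace G U -> pieces U.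
Proof.
move=> UN Ugr; rewrite /pieces {1}Ugr; apply: subv_big_seq => j _.
have [ja|ja] := lerP j (- a).
  by rewrite (subv_trans (capvSr _ _)) // (subv_trans (gpart_sub_P ja)) ?addvSl.
have [->|jW] := eqVneq j (b - a).
  by rewrite (subv_trans (addvSl _ (U :&: V)%VS)) // addvSr.
have [->|jV] := eqVneq j (- b).
  by rewrite (subv_trans (addvSr (U :&: W)%VS _)) // addvSr.
(* In all other degrees [N] has no component. *)
apply/subvP=> x /memv_capP[xU xj]; suff -> : x = 0 by rewrite mem0v.
apply: (@gpart_disjoint _ _ G j x [pred i | (i <= - a) || (i \in [:: b - a; - b])]) => //.
  by rewrite !inE !negb_or jW jV -ltNge ja.
apply: (subvP _ _ (subvP UN _ xU)); rewrite N_decomp !subv_add.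
rewrite !gpart_sub_sum /= ?inE ?eqxx ?orbT // !andbT.
by apply: subv_big_seq => i ia; apply: gpart_sub_sum; rewrite /= ia.
Qed.

Lemma graded_of_pieces U : (P <= U)%VS -> pieces U -> graded_subspace G U.
Proof.
move=> PU Up; apply/eqP; rewrite eqEsubv; apply/andP; split; last first.
  by apply: subv_big_seq => j _; apply: capvSl.
have sub j X : (X <= U)%VS -> (X <= G j)%VS -> (X <= \sum_(i <- gsupp G) (U :&: G i))%VS.
  move=> XU Xj; have [js|js] := boolP (j \in gsupp G); last first.
    by rewrite (subv_trans Xj) // gpart0 // sub0v.
  by rewrite (big_rem j) //= (subv_trans _ (addvSl _ _)) // subv_cap XU.
apply: (subv_trans Up); rewrite !subv_add.
rewrite (sub (b - a) (U :&: W)%VS) ?capvSl ?capvSr // (sub (- b) (U :&: V)%VS) ?capvSl ?capvSr // !andbT.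
apply: subv_big_seq => i ia; apply: (sub i) => //.
exact: subv_trans (gpart_sub_P ia) PU.
Qed.

Lemma pieces_sub_M U : (P <= U)%VS -> (U <= M)%VS -> U = (P + (U :&: W))%VS.
Proof. by move=> PU UM; rewrite capvC vspace_modl //; apply/esym/capv_idPr. Qed.

Lemma pieces_M U : (P <= U)%VS -> (U <= M)%VS -> pieces U.
Proof.
by move=> PU UM; rewrite /pieces {1}(pieces_sub_M PU UM) addvS // addvSl.
Qed.

(** Admissibility relative to [G] in working form: (A3) becomes [adm_perp], and (A6) is recovered
    from it in [adm_admissible] by counting dimensions. *)
Record adm m n : Prop := Adm {
  adm_Pm : (P <= m)%VS;
  adm_mn : (m <= n)%VS;
  adm_nN : (n <= N)%VS;
  adm_mp : pieces m;
  adm_np : pieces n;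
  adm_nn : lie_subalgebra n;
  adm_nm : forall x y, x \in n -> y \in m -> lie x y \in m;
  adm_perp : perp m = (n + Z)%VS;
  adm_nZ : (n :&: Z = 0)%VS }.

Lemma adm_mZ m n : adm m n -> (m :&: Z = 0)%VS.
Proof.
by move=> mn; apply/eqP; rewrite -subv0 -(adm_nZ mn) capvS // (adm_mn mn).
Qed.

Lemma adm_admissible m n : adm m n -> admissible_rel e G m n.
Proof.
move=> mnP; have mZ := adm_mZ mnP; case: mnP => Pm mn nN mp np nn nm mperp nZ.
exists a; split=> //.
- by move=> x y xm ym; apply: nm; rewrite ?(subvP mn).
- by split; apply: graded_of_pieces => //; apply: subv_trans mn.
- exact/killing_perp_commutatorP.
- have := dim_omega_perp simp mZ; rewrite mperp dimv_disjoint_sum // addnA => <-.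
  by rewrite addnK.
Qed.

Lemma admissible_adm m n : admissible_rel e G m n -> adm m n.
Proof.
move=> [a' [ms ns a'1 ea' [mgr ngr] [Pm mn nN] A3 A4 A5 A6]].
(* A nonzero [e] has only one degree. *)
have aa : a' = a by apply: (gpart_inj_degree ea' e_deg).
rewrite aa in Pm; split=> //; try apply: pieces_of_graded => //.
  exact: subv_trans nN.
exact/killing_perp_commutatorP.
Qed.

Lemma adm_equiv m n m' n' : adm m n -> adm m' n' ->
  (m <= m')%VS -> (n' <= n)%VS ->
  equivalent_pairs e (m, n) (m', n') /\ equivalent_pairs e (m', n') (m, n).
Proof.
move=> A B mm nn; suff E : equivalent_pairs e (m, n) (m', n').
  by split=> //; apply: equivalent_pairs_sym.
apply: comparable_equivalent_pairs; exists G; split; try exact: adm_admissible.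
by left; split=> //; apply: adm_mn B.
Qed.

Local Notation compl := (complement_above P M Z).

Lemma compl_addZ C : compl C -> (C + Z = M + Z)%VS.
Proof.
move=> [_ CM MC _]; apply/eqP; rewrite eqEsubv addvS //=.
by apply: (subv_trans (addvS MC (subvv Z))); rewrite -addvA addvv.
Qed.

(** The argument common to both cases, with [k C] the normal form attached to [C]. Complements
    sharing a hyperplane [H] have equivalent normal forms, since the pair supplied by [H] is joined
    to both. *)
Lemma adm_connected (k : {vspace g} -> {vspace g} * {vspace g}) :
  (forall m n C, adm m n -> compl C -> (n :&: M <= C)%VS ->
     equivalent_pairs e (m, n) (k C)) ->
  (forall C H, compl C -> (P <= H)%VS -> (H <= C)%VS -> \dim C = (\dim H).+1 ->
     exists m n, adm m n /\ (n :&: M <= H)%VS) ->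
  (forall C, compl C -> admissible_pair e (k C)) ->
  forall m n m' n', adm m n -> adm m' n' -> equivalent_pairs e (m, n) (m', n').
Proof.
move=> kA kB kadm m n m' n' mn mn'.
have ex U U' : adm U U' -> exists2 C, compl C & (U' :&: M <= C)%VS.
  move=> UU'; apply: exists_complement_above; rewrite ?capvSr //.
    by rewrite subv_cap addvSl (subv_trans (adm_Pm UU')) // (adm_mn UU').
  by apply/eqP; rewrite -subv0 -(adm_nZ UU') capvS // capvSl.
have [C CP nC] := ex _ _ mn; have [C' CP' nC'] := ex _ _ mn'.
apply: (equivalent_pairs_trans (kA _ _ _ mn CP nC)).
apply: equivalent_pairs_trans (equivalent_pairs_sym (kA _ _ _ mn' CP' nC')).
apply: (@complement_above_connected _ _ P M Z
  (fun C1 C2 => equivalent_pairs e (k C1) (k C2))) CP CP' => [C1 C1P|C1 C2 C3|].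
- exact/equivalent_pairs_refl/kadm.
- exact: equivalent_pairs_trans.
move=> C1 C2 H C1P C2P PH HC1 HC2 dC.
have [u [v [uv vH]]] := kB _ _ C1P PH HC1 dC.
apply: (equivalent_pairs_trans (equivalent_pairs_sym
  (kA _ _ _ uv C1P (subv_trans vH HC1)))).
exact: kA _ _ _ uv C2P (subv_trans vH HC2).
Qed.

(** * The case 2b = a *)

Section Balanced.
Hypothesis b2_eq : b *+ 2 = a.

Lemma balanced_WV : W = V.
Proof. by congr (G _); lia. Qed.

Lemma balanced_N : N = M.
Proof. by rewrite N_decomp balanced_WV addvv. Qed.

(** Here N = M, so all brackets in [N] fall into [P] and every subspace between [P] and [N] is
    graded. *)
Lemma balanced_adm m n : (P <= m)%VS -> (m <= n)%VS -> (n <= N)%VS ->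
  perp m = (n + Z)%VS -> (n :&: Z = 0)%VS -> adm m n.
Proof.
move=> Pm mn nN mperp nZ; have nM : (n <= M)%VS by rewrite -balanced_N.
split=> //.
- exact/pieces_M/(subv_trans mn).
- by apply: pieces_M => //; apply: subv_trans mn.
- move=> x y xn yn; apply: (subvP (subv_trans Pm mn)).
  by apply: lie_NM; [apply: (subvP nN)|apply: (subvP nM)].
- move=> x y xn ym; apply: (subvP Pm).
  by apply: lie_NM; [apply: (subvP nN)|apply: (subvP (subv_trans mn nM))].
Qed.

Lemma balanced_normal_form C : compl C -> adm P C.
Proof.
move=> CP; have [PC CM _ CZ] := CP; apply: balanced_adm => //.
  by rewrite balanced_N.
by rewrite (compl_addZ CP) -balanced_N perpP.
Qed.

(** The pair is (m, H) with [m] the orthogonal of [H] inside [C]. A dimension count makes [m] equal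
    to [P] plus a line, and m <= H follows because a line is isotropic. *)
Lemma balanced_hyperplane C H : compl C -> (P <= H)%VS -> (H <= C)%VS ->
  \dim C = (\dim H).+1 -> exists m n, adm m n /\ (n :&: M <= H)%VS.
Proof.
move=> CP PH HC dC; have [PC CM MC CZ] := CP.
have sub0 A : (A <= C)%VS -> (A :&: Z = 0)%VS.
  by move=> AC; apply/eqP; rewrite -subv0 -CZ capvS.
have PZ := sub0 _ PC; have HZ := sub0 _ HC.
have perpPE : perp P = (C + Z)%VS by rewrite (compl_addZ CP) -balanced_N perpP.
have CperpP : (C <= perp P)%VS by rewrite perpPE addvSl.
pose m := (perp H :&: C)%VS.
have mC : (m <= C)%VS by apply: capvSr.
have mZ := sub0 _ mC.
have Pm : (P <= m)%VS.
  by rewrite subv_cap PC andbT omega_perp_sym // (subv_trans HC).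
(* The orthogonal of [H] lies in that of [P], which is C + Z, so the modular law applies. *)
have perpH : perp H = (m + Z)%VS.
  rewrite /m vspace_modr ?centralizer_omega_perp //.
  by apply/esym/capv_idPl; rewrite -perpPE omega_perpS.
have dP := dim_omega_perp simp PZ; have dH := dim_omega_perp simp HZ; have dm := dim_omega_perp simp mZ.
rewrite perpPE dimv_disjoint_sum // in dP; rewrite perpH dimv_disjoint_sum // in dH.
have dmP : \dim m = (\dim P).+1.
  move: dP dH dC; clear.
  move: (\dim P) (\dim C) (\dim Z) (\dim H) (\dim m) (\dim {:g}).
  by move=> *; lia.
have [v vm vP] : exists2 v, v \in m & v \notin P.
  by apply/subvPn/negP=> /dimvS; rewrite dmP ltnn.
have mE : m = (P + <[v]>)%VS.
  by apply/esym/eqP; rewrite eqEdim subv_add Pm -memvE vm dim_add_line ?dmP /=.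
have vC := subvP mC _ vm.
have perpm : perp m = (H + Z)%VS.
  apply/esym/eqP; rewrite eqEdim subv_add centralizer_omega_perp andbT.
  rewrite omega_perp_sym ?capvSl //= dimv_disjoint_sum //; move: dP dm dC dmP; clear.
  move: (\dim P) (\dim C) (\dim Z) (\dim H) (\dim m) (\dim (perp m)) (\dim {:g}).
  by move=> *; lia.
(* [v] is orthogonal to [P] and to itself, hence to [m], so it lies in H + Z; its component in [Z]
   belongs to C ∩ Z = 0. *)
have mH : (m <= H)%VS.
  rewrite mE subv_add PH -memvE.
  have : v \in (H + Z)%VS.
    rewrite -perpm mE omega_perpD memv_cap (subvP CperpP) //=.
    exact: (subvP (omega_perp_line e v)) (memv_line v).
  move=> /memv_addP[h hH [z zZ vE]]; have hC := subvP HC _ hH.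
  have : z \in (C :&: Z)%VS by rewrite memv_cap zZ -[z](addKr h) -vE memvD ?memvN.
  by rewrite CZ memv0 vE => /eqP->; rewrite addr0.
exists m, H; split; last exact: capvSl.
by apply: balanced_adm => //; rewrite balanced_N (subv_trans HC).
Qed.

Lemma balanced_equivalent m n m' n' : adm m n -> adm m' n' ->
  equivalent_pairs e (m, n) (m', n').
Proof.
apply: (@adm_connected (fun C => (P, C))).
- move=> x y C xy CP yC.
  apply: (adm_equiv (balanced_normal_form CP) xy (adm_Pm xy) _).2.
  by apply: subv_trans yC; rewrite subv_cap subvv -balanced_N (adm_nN xy).
- exact: balanced_hyperplane.
- by move=> C /balanced_normal_form/adm_admissible; exists G.
Qed.

End Balanced.

(** * The case 2b < a *)

Section Unbalanced.
Hypothesis b2_lt : b *+ 2 < a.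

Lemma sub_perp_gpart i j : i + j + a != 0 -> (G i <= perp (G j))%VS.
Proof.
move=> ij; apply/subvP=> x xi; apply/omega_perpP=> y yj.
by rewrite omegaE (killing_gpart (gpart_lie xi yj) e_deg).
Qed.

Lemma M_sub_perpM : (M <= perp M)%VS.
Proof.
rewrite omega_perpD subv_cap (subv_trans sub_MN N_sub_perpP) /= subv_add.
rewrite (omega_perp_sym (subv_trans sub_WN N_sub_perpP)) /=.
by apply: sub_perp_gpart; lia.
Qed.

Lemma V_sub_perpV : (V <= perp V)%VS.
Proof. by apply: sub_perp_gpart; lia. Qed.

(** A vector orthogonal to [M] lies in N + Z = M + V + Z. Its [V] component is orthogonal to [W],
    hence in [Z]. *)
Lemma perpM : perp M = (M + Z)%VS.
Proof.
apply/eqP; rewrite eqEsubv subv_add M_sub_perpM centralizer_omega_perp !andbT.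
apply/subvP=> x xM.
have : x \in (N + Z)%VS by rewrite -perpP (subvP (omega_perpS _ (addvSl _ W))).
rewrite N_MV => /memv_addP[_ /memv_addP[u uM [v vV ->]] [z zZ xE]].
rewrite xE -addrA memv_add //; apply: memvD => //; apply: V_perpW => //.
have -> : v = x - z - u by rewrite xE addrK [u + v]addrC addrK.
have xW := subvP (omega_perpS e (addvSr P W)).
rewrite !memvB ?xW //; last exact: (subvP M_sub_perpM).
by apply: (subvP (centralizer_omega_perp e M)).
Qed.

Lemma V_capMZ x : x \in V -> x \in (M + Z)%VS -> x \in Z.
Proof.
move=> xV; rewrite -perpM => /(subvP (omega_perpS e (addvSr P W))).
exact: V_perpW.
Qed.

Lemma compl_perp C : compl C -> perp C = (C + Z)%VS.
Proof. by move=> CP; rewrite -omega_perpDZ (compl_addZ CP) omega_perpDZ perpM. Qed.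

(** [C] is its own orthogonal modulo [Z], and its brackets fall into [P]. *)
Lemma unbalanced_normal_form C : compl C -> adm C C.
Proof.
move=> CP; have [PC CM _ CZ] := CP; have CN := subv_trans CM sub_MN.
split=> //; try exact: pieces_M; try exact: compl_perp.
all: move=> x y xC yC; apply: (subvP PC).
all: by apply: lie_NM; [apply: (subvP CN)|apply: (subvP CM)].
Qed.

(** Shrinking [m] to m ∩ M enlarges its orthogonal only by vectors of [M], and these are accounted
    for by C + Z. *)
Lemma adm_intermediate m n C : adm m n -> compl C -> (n :&: M <= C)%VS ->
  adm (m :&: M)%VS (n + C)%VS.
Proof.
move=> mnP CP nC; have [PC CM MC CZ] := CP; have CN := subv_trans CM sub_MN.
case: mnP => Pm mn nN mp np nn nm mperp nZ.
have PmM : (P <= m :&: M)%VS by rewrite subv_cap Pm addvSl.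
(* A graded subspace containing [P] is the sum of its parts in [M] and in [V]. *)
have nsplit (U : {vspace g}) x : pieces U -> (P <= U)%VS -> x \in U ->
    exists u v, [/\ u \in (U :&: M)%VS, v \in (U :&: V)%VS & x = u + v].
  move=> Up PU xU; have := subvP Up _ xU.
  rewrite addvA => /memv_addP[u uX [v vV ->]]; exists u, v; split=> //.
  apply: (subvP _ _ uX); rewrite subv_add !subv_cap PU addvSl capvSl /=.
  by rewrite (subv_trans (capvSr _ _)) // addvSr.
have Pn := subv_trans Pm mn.
split.
- exact: PmM.
- by rewrite (subv_trans (capvSl _ _)) // (subv_trans mn) // addvSl.
- by rewrite subv_add nN.
- exact: pieces_M (capvSr _ _).
- rewrite /pieces {1}(pieces_sub_M PC CM) subv_add.
  apply/andP; split; first by rewrite (subv_trans np) // !addvS ?capvS ?addvSl.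
  by rewrite subv_add addvSl (subv_trans _ (addvSr _ _)) // (subv_trans _ (addvSl _ _)) // capvS ?addvSr.
- move=> p q /memv_addP[x xn [c cC ->]] /memv_addP[y yn [d dC ->]].
  apply: (subvP (addvSl n C)); rewrite lieDr memvD //.
    rewrite lieDl; apply: memvD; first exact: nn.
    by apply/(subvP Pn)/lie_MN; [apply: (subvP CM)|apply: (subvP nN)].
  apply/(subvP Pn)/lie_NM; last exact: (subvP CM).
  by apply: memvD; [apply: (subvP nN)|apply: (subvP CN)].
- move=> x y xnC /memv_capP[_ yM]; apply: (subvP PmM); rewrite lie_NM //.
  by apply: (subvP _ _ xnC); rewrite subv_add nN.
- apply/eqP; rewrite eqEsubv !subv_add centralizer_omega_perp andbT.
  have mMm := omega_perpS e (capvSl m M); have mMM := omega_perpS e (capvSr m M).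
  rewrite (subv_trans _ mMm) /=; last by rewrite mperp addvSl.
  rewrite (subv_trans CM) ?(subv_trans M_sub_perpM) // andbT.
  apply/subvP=> x xm.
  have : x \in (N + Z)%VS by rewrite -perpP (subvP (omega_perpS _ PmM)).
  rewrite N_MV => /memv_addP[_ /memv_addP[u uM [v vV ->]] [z zZ xE]].
  (* [v] is orthogonal to m ∩ M, as [u] and [z] are, and to [V], which is isotropic; these cover all
     of [m]. *)
  have vm : v \in perp m.
    apply/omega_perpP=> y ym; have [y1 [y2 [y1M /memv_capP[_ y2V] ->]]] := nsplit m y mp Pm ym.
    have vmM : v \in perp (m :&: M)%VS.
      have -> : v = x - z - u by rewrite xE addrK [u + v]addrC addrK.
      rewrite !memvB //; last exact: (subvP (subv_trans M_sub_perpM mMM)).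
      exact: (subvP (centralizer_omega_perp e _)).
    have /omega_perpP vV' : v \in perp V.
      exact: (subvP V_sub_perpV).
    rewrite /omega lieDl killingDr -/(omega e v y1) -/(omega e v y2).
    by rewrite (vV' y2) // addr0; move/omega_perpP: vmM => ->.
  rewrite xE memvD //; last by rewrite (subvP (addvSr _ _)).
  rewrite memvD //.
    have := subvP MC _ uM; apply: subvP; by rewrite addvS // addvSr.
  by move: vm; rewrite mperp; apply: subvP; rewrite addvS // addvSl.
- apply/eqP; rewrite -subv0; apply/subvP=> x /memv_capP[].
  move=> /memv_addP[y yn [c cC ->]].
  have [u [v [uM /memv_capP[vn vV] ->]]] := nsplit n y np Pn yn.
  have uC := subvP nC _ uM.
  (* The [V] component of an element of (n + C) ∩ Z lies in M + Z, hence in [Z], hence in n ∩ Z = 0.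
     What remains is in C ∩ Z. *)
  move=> sZ; have vZ : v \in Z.
    apply: V_capMZ => //; have -> : v = - (u + c) + (u + v + c).
      by rewrite addrAC addKr.
    by rewrite memv_add // memvN memvD // (subvP CM).
  have v0 : v = 0 by apply/eqP; rewrite -memv0 -nZ memv_cap vn.
  by rewrite v0 addr0 -CZ memv_cap memvD //= -[u]addr0 -v0.
Qed.

(** The pair is (m, m), where [m] is [H] plus a line of [V] orthogonal to [H]: the line lost from
    [C] is replaced by one outside [M]. *)
Lemma unbalanced_hyperplane C H : compl C -> (P <= H)%VS -> (H <= C)%VS ->
  \dim C = (\dim H).+1 -> exists m n, adm m n /\ (n :&: M <= H)%VS.
Proof.
move=> CP PH HC dC; have [PC CM MC CZ] := CP; have HM := subv_trans HC CM.
have HZ : (H :&: Z = 0)%VS by apply/eqP; rewrite -subv0 -CZ capvS.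
have dH := dim_omega_perp simp HZ; have dCp := dim_omega_perp simp CZ.
have perpC : perp C = (M + Z)%VS by rewrite (compl_perp CP) (compl_addZ CP).
have MZH : (M + Z <= perp H)%VS by rewrite -perpC omega_perpS.
(* The orthogonal of [H] has one dimension more than that of [C], which is M + Z. *)
have [x xH xM] : exists2 x, x \in perp H & x \notin (M + Z)%VS.
  apply/subvPn/negP=> /dimvS; rewrite -perpC; move: dH dCp dC; clear.
  move: (\dim C) (\dim H) (\dim (perp C)) (\dim (perp H)) (\dim {:g}).
  by move=> *; lia.
(* The components of [x] in [M] and [Z] are orthogonal to [H], so its component in [V] is too. *)
have [v [vV vH vM]] : exists v, [/\ v \in V, v \in perp H & v \notin (M + Z)%VS].
  have : x \in (N + Z)%VS by rewrite -perpP (subvP (omega_perpS _ PH)).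
  rewrite N_MV => /memv_addP[_ /memv_addP[u uM [v vV ->]] [z zZ xE]].
  have uzM : u + z \in (M + Z)%VS by rewrite memv_add.
  have {}xE : x = (u + z) + v by rewrite xE addrAC.
  have vE : v = x - (u + z) by rewrite xE addrC addKr.
  exists v; split=> //; first by rewrite vE memvB // (subvP MZH).
  apply: contra xM => vM.
  by rewrite xE memvD.
have vM' : v \notin M by apply: contra vM; apply: (subvP (addvSl _ _)).
have vH' : v \notin H by apply: contra vM'; apply: (subvP HM).
pose m := (H + <[v]>)%VS.
have vN : v \in N := subvP sub_VN _ vV.
have HN := subv_trans HM sub_MN.
have mN : (m <= N)%VS by rewrite subv_add HN -memvE.
have Pm : (P <= m)%VS by rewrite (subv_trans PH) ?addvSl.
have mM U t h : (M <= U)%VS -> v \notin U -> h \in H -> h + t *: v \in U -> t = 0.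
  move=> MU vU /(subvP HM)/(subvP MU) hU huU; have tU : t *: v \in U.
    by rewrite -[t *: v](addKr h) memvD ?memvN.
  have [//|t0] := eqVneq t 0; case/negP: vU.
  by rewrite -[v](scalerK t0) memvZ.
have mZ : (m :&: Z = 0)%VS.
  apply/eqP; rewrite -subv0; apply/subvP=> y /memv_capP[].
  move=> /memv_addP[h hH [_ /vlineP[t ->] ->{y}]] yZ.
  have t0 : t = 0.
    by apply: (mM (M + Z)%VS t h) => //; rewrite ?addvSl ?(subvP (addvSr M Z)).
  by move: yZ; rewrite t0 scale0r addr0 -HZ memv_cap hH.
have mm x' y : x' \in m -> y \in m -> lie x' y \in m.
  move=> /memv_addP[h hH [_ /vlineP[t ->] ->]] ym; apply: (subvP Pm).
  rewrite lieDl lieZl; apply: memvD.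
    by apply: lie_MN; [apply: (subvP HM)|apply: (subvP mN)].
  apply: memvZ; move: ym => /memv_addP[k kH [_ /vlineP[r ->] ->{y}]].
  by rewrite lieDr lieZr lie_alt scaler0 addr0 lie_NM // (subvP HM).
exists m, m; split; last first.
  apply/subvP=> y /memv_capP[].
  move=> /memv_addP[h hH [_ /vlineP[t ->] ->{y}]] yM.
  by rewrite (mM M t h) // scale0r addr0.
have mp : pieces m.
  have mV : (<[v]> <= m :&: V)%VS by rewrite subv_cap addvSr -memvE.
  have mW : (H <= P + (m :&: W))%VS.
    by rewrite {1}(pieces_sub_M PH HM) addvS // capvS // addvSl.
  by rewrite /pieces addvA; apply: addvS mW mV.
have perpm : perp m = (m + Z)%VS.
  apply/esym/eqP; rewrite eqEdim subv_add centralizer_omega_perp andbT.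
  apply/andP; split.
    have HvP : (H <= perp <[v]>)%VS by rewrite omega_perp_sym -?memvE.
    rewrite omega_perpD subv_cap !subv_add HvP omega_perp_line -memvE vH !andbT.
    by rewrite (subv_trans HM) // (subv_trans (addvSl M Z)).
  have := dim_omega_perp simp mZ; rewrite dimv_disjoint_sum // dim_add_line //.
  move: dCp; rewrite (compl_perp CP) dimv_disjoint_sum //; move: dC; clear.
  move: (\dim C) (\dim H) (\dim Z) (\dim (perp m)) (\dim {:g}).
  by move=> *; lia.
by split.
Qed.

Lemma unbalanced_equivalent m n m' n' : adm m n -> adm m' n' ->
  equivalent_pairs e (m, n) (m', n').
Proof.
apply: (@adm_connected (fun C => (C, C))).
(* The intermediate pair has the smallest first member and the largest second member, so it is
   comparable with both other pairs. *)
- move=> x y C xy CP yC; have mid := adm_intermediate xy CP yC.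
  apply: equivalent_pairs_trans
    (adm_equiv mid (unbalanced_normal_form CP) _ (addvSr _ _)).1.
    exact: (adm_equiv mid xy (capvSl _ _) (addvSl _ _)).2.
  by rewrite (subv_trans _ yC) // capvS // (adm_mn xy).
- exact: unbalanced_hyperplane.
- by move=> C /unbalanced_normal_form/adm_admissible; exists G.
Qed.

End Unbalanced.

End AdmissiblePairs.

(** * Conclusion: the case e = 0 and the assembly of the two cases *)

Local Open Scope complex_scope.

Theorem mainTheorem6 (R : realType) (g : lieAlgType R[i]) (e : g)
    (G : grading g) (a b : int)
    (hg : lie_simple g)
    (he : lie_nilpotent e)
    (hG : admissible_grading e G)
    (ha : 1 < a)
    (hea : e \in G a)
    (hb : 0 < b /\ b *+ 2 <= a)
    (hsum : grading_lt G 0 = (grading_le G (- a) + (G (b - a) + G (- b)))%VS)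
    (hdirect : (grading_le G (- a) :&: (G (b - a) + G (- b)))%VS = 0%VS) :
  forall m n m' n' : {vspace g},
    admissible_rel e G m n -> admissible_rel e G m' n' ->
    equivalent_pairs e (m, n) (m', n').
Proof.
move=> m n m' n' mn mn'; have [b0 b2a] := hb.
(* For e = 0 the centralizer is all of g, so (A4) forces both members of every pair to be zero. *)
have [e0|e_neq0] := eqVneq e 0.
  have zero p q : admissible_rel e G p q -> p = 0%VS /\ q = 0%VS.
    move=> [a' pq]; have [_ pq_sub _] := adm_A2sub pq.
    have q0 : q = 0%VS.
      rewrite -[RHS](adm_A4 pq); apply/esym/capv_idPl/subvP=> x _.
      by rewrite mem_centralizer e0 lie0r.
    by split=> //; apply/eqP; rewrite -subv0 -[X in (_ <= X)%VS]q0.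
  have [m0 n0] := zero _ _ mn; have [m'0 n'0] := zero _ _ mn'.
  have -> : m' = m by rewrite m'0.
  have -> : n' = n by rewrite n'0.
  by apply: equivalent_pairs_refl; exists G.
have mnP := admissible_adm hea e_neq0 hsum mn.
have mnP' := admissible_adm hea e_neq0 hsum mn'.
have := b2a; rewrite le_eqVlt => /orP[/eqP b2_eq|b2_lt].
  exact: (balanced_equivalent hg ha hea e_neq0 b0 b2a hsum b2_eq mnP mnP').
exact: (unbalanced_equivalent hg ha hea e_neq0 b0 b2a hsum b2_lt mnP mnP').
Qed.
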